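(* For all $j\in S$ and $\lambda>0$, $$\delta_{j,r}(\lambda)=\frac{\xi}{\lambda+\xi}-\frac{\lambda}{\lambda+\xi}\,\frac{\xi\,\widehat\pi_{j,r}(\lambda+\xi)}{1-\xi\,\widehat\pi_{r,r}(\lambda+\xi)}.$$ Moreover, for all $j\in\{r+1,r+2,\ldots\}$ and $\lambda>0$, $$\delta_{j,r}(\lambda)=\gamma_{j,r}(\lambda)-\frac{\lambda}{\lambda+\xi}\,\frac{\widehat\gamma_{j,r}(\lambda+\xi)}{1-\xi\,\widehat\pi_{r,r}(\lambda+\xi)}.$$
   Context: Let $r$ be a nonnegative integer, $S=\{r,r+1,r+2,\ldots\}$, and let $\alpha_n>0$ ($n\ge r$), $\beta_n\ge 0$ ($n\ge r+1$), $\xi>0$ be constants. $\{N(t);t\ge 0\}$ is the continuous-time Markov chain on $S$ (birth-death process with catastrophes) with transitions: $n\to n+1$ with rate $\alpha_n$ for $n\ge r$; $n\to n-1$ with rate $\beta_n$ for $n\ge r+2$; $r+1\to r$ with rate $\beta_{r+1}+\xi$; $n\to r$ with rate $\xi$ for $n\ge r+2$. $\{\widehat N(t);t\ge 0\}$ is the birth-death process on $S$ with the same birth rates $\alpha_n$ and death rates $\beta_n$ but without catastrophes (i.e. its only transitions are $n\to n+1$ with rate $\alpha_n$ for $n\ge r$ and $n\to n-1$ with rate $\beta_n$ for $n\ge r+1$). Its transition probabilities are $\widehat p_{j,n}(t)=\Pr\{\widehat N(t)=n\mid\widehat N(0)=j\}$, and it is assumed non-explosive: $\sum_{n\ge r}\widehat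 p_{j,n}(t)=1$ for all $j\in S$, $t\ge0$. Put $\widehat\pi_{j,n}(\lambda)=\int_0^\infty e^{-\lambda t}\widehat p_{j,n}(t)\,dt$ for $\lambda>0$. For $j>r$, $T_{j,r}=\inf\{t\ge 0: N(t)=r\}$ given $N(0)=j$, with density $g_{j,r}$ and Laplace transform $\gamma_{j,r}(\lambda)=\int_0^\infty e^{-\lambda t}g_{j,r}(t)\,dt$; likewise $\widehat T_{j,r}$, its (possibly defective) density $\widehat g_{j,r}$ and Laplace transform $\widehat\gamma_{j,r}$ for $\widehat N(t)$. An effective catastrophe is a catastrophe (rate $\xi$) occurring when $N(t)$ is in a state $n>r$ (from state $r+1$, transitions to $r$ due to a catastrophe, rate $\xi$, are distinguished from those due to a death, rate $\beta_{r+1}$). $C_{j,r}$ is the time of the first effective catastrophe when $N(0)=j\in S$. Formally, let $\{M(t)\}$ be the continuous-time Markov chain on $\{r-1,r,r+1,\ldots\}$ with $r-1$ absorbing and transitions $n\to n+1$ with rate $\alpha_n$ ($n\ge r$), $n\to n-1$ with rate $\beta_n$ ($n\ge r+1$), $n\to r-1$ with rate $\xi$ ($n\ge r+1$); then $\Pr(C_{j,r}<t)=\Pr\{M(t)=r-1\mid M(0)=j\}$. $d_{j,r}$ is the density of $C_{j,r}$ and $\delta_{j,r}(\lambda)=\int_0^\infty e^{-\lambda t}d_{j,r}(t)\,dt$. *)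

(* Defs.v *)
From HB Require Import structures.
From mathcomp Require Import all_boot all_order all_algebra.
From mathcomp Require Import all_classical all_reals all_analysis.
From mathcomp Require Import measurable_realfun lebesgue_measure lebesgue_integral.
Set Implicit Arguments.
Unset Strict Implicit.
Unset Printing Implicit Defensive.
Import Order.TTheory GRing.Theory Num.Theory.
Import numFieldNormedType.Exports.
Local Open Scope classical_set_scope.
Local Open Scope ring_scope.

(* A continuous-time Markov chain on a countable state space E is given by its
   off-diagonal transition rates q, each state having finitely many possible
   successors (the finitely supported sum below is the total rate only in that
   case). *)
Definition exit_rate (R : realType) (E : countType) (q : E -> E -> R) (i : E) : R :=
  \sum_(k \in [set k | k != i]) q i k.

Definition jump_prob (R : realType) (E : countType) (q : E -> E -> R) (i k : E) : R :=
  if exit_rate q i == 0 then (k == i)%:R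
  else if k == i then 0 else q i k / exit_rate q i.

Definition jump_time (R : realType) (Omega : Type) (H : nat -> Omega -> \bar R)
    (n : nat) (w : Omega) : \bar R :=
  (\sum_(k < n) H k w)%E.

(* Under P, X is the (minimal) right-continuous Markov chain with rates q started
   at j: its successive states Y form a discrete-time Markov chain with transition
   matrix jump_prob q and, given Y, the holding times H k are independent and
   exponential of parameter exit_rate q (Y k); parameter 0 means that the holding
   time is almost surely +oo.  X t w = None means that the path w has made
   infinitely many jumps by time t (explosion). *)
Definition is_markov_chain (R : realType) (E : countType) (q : E -> E -> R) (j : E)
    (d : measure_display) (Omega : measurableType d) (P : probability Omega R)
    (X : R -> Omega -> option E) : Prop :=
  exists (Y : nat -> Omega -> E) (H : nat -> Omega -> \bar R),
  [/\ forall k e, measurable [set w | Y k w = e],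
      forall k, measurable_fun [set: Omega] (H k),
      forall k w, (0 < H k w)%E,
      forall (n : nat) (y : nat -> E) (s : nat -> R), (forall k, 0 <= s k) ->
        P [set w | (forall k, (k < n)%N -> Y k w = y k /\ ((s k)%:E < H k w)%E)
                   /\ Y n w = y n]
        = ((y 0%N == j)%:R *
           \prod_(k < n) (expR (- exit_rate q (y k) * s k) *
                          jump_prob q (y k) (y k.+1)))%:E
    & forall (t : R) w e, 0 <= t ->
        (X t w = Some e <->
         exists n, Y n w = e /\
           (jump_time H n w <= t%:E < jump_time H n.+1 w)%E)].

(* States below r get rate 0: they are never reached from {r, r+1, ...}. *)
Definition catastrophe_rate (R : realType) (r : nat) (alpha beta : nat -> R) (xi : R)
    (n m : nat) : R :=
  if (n < r)%N then 0
  else if m == n.+1 then alpha n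
  else if (n == r.+1) && (m == r) then beta r.+1 + xi
  else if (r.+2 <= n)%N && (m == n.-1) then beta n
  else if (r.+2 <= n)%N && (m == r) then xi
  else 0.

Definition birth_death_rate (R : realType) (r : nat) (alpha beta : nat -> R)
    (n m : nat) : R :=
  if (n < r)%N then 0
  else if m == n.+1 then alpha n
  else if (r.+1 <= n)%N && (m == n.-1) then beta n
  else 0.

(* The state space {r-1, r, r+1, ...} of M is embedded in option nat: None stands
   for the absorbing state r-1 and Some n for n >= r. *)
Definition effective_catastrophe_rate (R : realType) (r : nat)
    (alpha beta : nat -> R) (xi : R) (a b : option nat) : R :=
  match a, b with
  | None, _ => 0
  | Some n, Some m => birth_death_rate r alpha beta n m
  | Some n, None => if (r.+1 <= n)%N then xi else 0
  end.

Definition hitting_time (R : realType) (E : Type) (Omega : Type)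
    (X : R -> Omega -> option E) (e : E) (w : Omega) : \bar R :=
  ereal_inf [set t%:E | t in [set t : R | 0 <= t /\ X t w = Some e]].

(* g is a density on [0, +oo[ of the (possibly defective) law with distribution
   function F. *)
Definition is_density (R : realType) (F : R -> \bar R) (g : R -> R) : Prop :=
  [/\ measurable_fun (`[0, +oo[ : set R) g,
      forall t : R, 0 <= t -> 0 <= g t
    & forall t : R, 0 <= t ->
        F t = (\int[lebesgue_measure]_(s in `[0%R, t]) (g s)%:E)%E].

Definition laplace (R : realType) (f : R -> R) (lambda : R) : R :=
  \int[lebesgue_measure]_(t in `[0%R, +oo[) (expR (- lambda * t) * f t).

(* Main.v *)
Require Import Defs.
From HB Require Import structures.
From mathcomp Require Import all_boot all_order all_algebra.
From mathcomp Require Import all_classical all_reals all_analysis.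
From mathcomp Require Import measurable_realfun lebesgue_measure lebesgue_integral.
From mathcomp Require Import ring lra.
Import Order.TTheory GRing.Theory Num.Theory.
Import numFieldNormedType.Exports.
Local Open Scope classical_set_scope.
Local Open Scope ring_scope.

(** Conditioning on the jump chain turns each Laplace transform of the theorem into a
    series [\sum_n (L^n f) j], where [L] is the transition operator of the jump chain
    killed at rate [lambda] (or [lambda + xi]) during the holding times.  Such a series
    solves [x = f + L x], that is, the backward equations of the chain.  With
    [mu := lambda + xi], a catastrophe acts like an additional killing at rate [xi], so
    that [delta], [gamma], [pihat(mu)] and [gammahat(mu)] obey the same three-term
    recurrence above [r], up to a constant source term [xi].

    Non-explosion says that [L^n 1] tends to [0] for the process without catastrophes, so
    a bounded solution of the homogeneous recurrence which satisfies the homogeneous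
    equation at [r], or vanishes there, is zero.  This applies to
    [delta - xi / mu + xi (1 - delta_r) pihat], to [pihat - pihat_r gammahat] and to
    [gamma - xi / mu - lambda / mu * gammahat].  The first identity evaluated at [r] gives
    [(1 - delta_r) (1 - xi pihat_r) = lambda / mu], and both formulas follow. *)

(** * Laplace transforms *)

(* [exp (- l h)], with the value [0] at [h = +oo]. *)
Definition disc {R : realType} (l : R) (h : \bar R) : R :=
  expR (- l * fine h) * (h != +oo%E)%:R.

(** Extended-real values make Tonelli and countable additivity available before any finiteness is
    known. *)
Definition elaplace {R : realType} (l : R) (F : R -> \bar R) : \bar R :=
  (\int[lebesgue_measure]_(t in `[0%R, +oo[) ((expR (- l * t))%:E * F t))%E.

Lemma measurable_natr_bool {R : realType} : measurable_fun setT (fun b : bool => b%:R : R).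
Proof. by []. Qed.

Lemma integral_expR_ray {R : realType} (l a : R) : 0 < l ->
  (\int[lebesgue_measure]_(t in `[a, +oo[) (expR (- l * t))%:E =
   (expR (- l * a) / l)%:E)%E.
Proof.
move=> l0.
have cE : continuous (fun t : R => expR (- l * t)).
  move=> x; apply: continuous_comp; last exact: continuous_expR.
  by apply: continuousM => //; exact: cst_continuous.
rewrite (@ge0_continuous_FTC2y _ _ (fun t : R => - (l^-1 * expR (- l * t))) a 0).
- by rewrite -EFinN opprK add0e mulrC.
- by move=> x _; exact: expR_ge0.
- exact: continuous_subspaceT.
- rewrite -oppr0 -(mulr0 l^-1); apply: cvgN; apply: cvgMr.
  rewrite (_ : (fun x => expR (- l * x)) = (fun z => expR (- z)) \o (fun z => l * z)).
    apply: (@cvg_comp _ _ _ _ _ _ (pinfty_nbhs R)); last exact: cvgr_expR.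
    exact: gt0_cvgMry.
  by apply: eq_fun => x; rewrite mulNr.
- by move=> x _; exact: ex_derive.
- by apply: cvgN; apply: cvgMr; exact/cvg_at_right_filter/cE.
- move=> x _; rewrite derive1N; last exact: ex_derive.
  rewrite derive1Ml; last exact: ex_derive.
  rewrite derive1_comp// derive1E.
  have /funeqP -> := @derive_expR R.
  by rewrite derive1Ml// derive1_id; field; lra.
Qed.

Section tonelli.
Context {d} {T : measurableType d} {R : realType}
  (mu : {sigma_finite_measure set T -> \bar R}) (l : R) (l0 : 0 < l).
Variables (W : T -> R) (J : T -> \bar R).
Hypotheses (mW : measurable_fun setT W) (W0 : forall x, 0 <= W x).
Hypotheses (mJ : measurable_fun setT J) (J0 : forall x, (0 <= J x)%E).

Let g (z : T * R) : \bar R :=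
  (W z.1 * (J z.1 <= z.2%:E)%E%:R * expR (- l * z.2))%:E.

Let mg : measurable_fun setT g.
Proof.
apply/measurable_EFinP.
apply: measurable_funM; last first.
  apply: measurableT_comp => //.
  by apply: measurable_funM => //; exact: measurable_snd.
apply: measurable_funM.
  by apply: measurableT_comp => //.
apply: (measurableT_comp measurable_natr_bool).
apply: measurable_fun_lee.
  by apply: measurableT_comp.
by apply/measurable_EFinP; exact: measurable_snd.
Qed.

Let g0 z : (0 <= g z)%E.
Proof. by rewrite lee_fin !mulr_ge0// expR_ge0. Qed.

Let gE x t : g (x, t) = ((expR (- l * t))%:E * (W x * (J x <= t%:E)%E%:R)%:E)%E.
Proof. by rewrite -EFinM mulrC. Qed.

Lemma measurable_tail :
  measurable_fun setT (fun t : R => (\int[mu]_x (W x * (J x <= t%:E)%E%:R)%:E)%E).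
Proof.
apply: (measurable_fun_fubini_tonelli_G (m1 := mu) (fun z : T * R => (W z.1 * (J z.1 <= z.2%:E)%E%:R)%:E)).
- apply/measurable_EFinP; apply: measurable_funM.
    by apply: measurableT_comp => //.
  apply: (measurableT_comp measurable_natr_bool).
  apply: measurable_fun_lee.
    by apply: measurableT_comp.
  by apply/measurable_EFinP; exact: measurable_snd.
- by move=> z; rewrite lee_fin mulr_ge0.
Qed.

(** After exchanging the integrals, [expR (- l * t)] is integrated over [t >= J x], which gives
    [disc l (J x) / l], with 0 on both sides when [J x = +oo]. Since [J >= 0], the indicator
    vanishes for [t < 0], so the transform may be taken over the whole line. *)
Lemma elaplace_tonelli :
  elaplace l (fun t => (\int[mu]_x (W x * (J x <= t%:E)%E%:R)%:E)%E) =
  (\int[mu]_x (W x * disc l (J x) / l)%:E)%E.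
Proof.
transitivity (\int[lebesgue_measure]_t \int[mu]_x g (x, t))%E.
  rewrite /elaplace integral_mkcond; apply: eq_integral => t _.
  rewrite patchE; case: ifPn => [|].
    rewrite inE /= in_itv /= andbT => t0.
    rewrite -ge0_integralZl_EFin ?expR_ge0//; last 2 first.
      by move=> x _; rewrite lee_fin mulr_ge0.
      apply/measurable_EFinP; apply: measurable_funM => //.
      apply: (measurableT_comp measurable_natr_bool).
      exact: measurable_fun_lee.
    by apply: eq_integral => x _; rewrite gE.
  rewrite notin_setE /= in_itv /= andbT => /negP; rewrite -ltNge => t0.
  rewrite integral0_eq// => x _; rewrite gE.
  suff -> : (J x <= t%:E)%E = false by rewrite mulr0 mule0.
  by apply/negbTE; rewrite -ltNge (lt_le_trans _ (J0 x))// lte_fin.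
rewrite -(fubini_tonelli (m1 := mu) (m2 := lebesgue_measure) g)//.
apply: eq_integral => x _.
under eq_integral do rewrite gE.
rewrite /disc /=; have [[a a0 ->]|->] : (exists2 a, 0 <= a & J x = a%:E) \/ J x = +oo%E.
    by case: (J x) (J0 x) => [a a0||] //; [left; exists a|right].
- rewrite /= mulr1.
  transitivity ((W x)%:E * \int[lebesgue_measure]_(t in `[a, +oo[) (expR (- l * t))%:E)%E; last first.
    by rewrite integral_expR_ray// -EFinM mulrA.
  rewrite -ge0_integralZl_EFin ?W0//=; last first.
    apply/measurable_EFinP; apply: measurableT_comp => //.
  rewrite [RHS]integral_mkcond; apply: eq_integral => t _.
  rewrite patchE mem_setE in_itv /= andbT lee_fin; case: ifPn => _.
    by rewrite mulr1 muleC.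
  by rewrite mulr0 mule0.
- have -> : W x * (expR (- l * fine +oo%E) * (+oo%E != +oo%E :> \bar R)%:R) / l = 0.
    by rewrite eqxx mulr0 mulr0 mul0r.
  apply: integral0_eq => t _.
  by rewrite leNgt ltry mulr0 mule0.
Qed.

End tonelli.

Section disc_theory.
Context {R : realType} (l : R) (l0 : 0 < l).

Lemma disc_ge0 (h : \bar R) : 0 <= disc l h.
Proof. by rewrite mulr_ge0 ?expR_ge0. Qed.

Lemma disc_le1 (h : \bar R) : (0 <= h)%E -> disc l h <= 1.
Proof.
case: h => [h||] //; rewrite /disc /=.
  by rewrite lee_fin mulr1 => h0; rewrite -expR0 ler_expR mulNr oppr_le0 mulr_ge0// ltW.
by rewrite ?eqxx mulr0.
Qed.

Lemma disc0 : disc l 0%E = 1.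
Proof. by rewrite /disc /= mulr0 expR0 mul1r. Qed.

Lemma discD (a b : \bar R) : (0 <= a)%E -> (0 <= b)%E ->
  disc l (a + b) = disc l a * disc l b.
Proof.
case: a b => [a||] [b||] //= _ _; rewrite /disc /= ?eqxx ?(mulr0, mul0r)//.
by rewrite !mulr1 -expRD mulrDr.
Qed.

Lemma disc_sum (n : nat) (h : nat -> \bar R) : (forall k, (0 <= h k)%E) ->
  disc l (\sum_(k < n) h k)%E = \prod_(k < n) disc l (h k).
Proof.
move=> h0; elim: n => [|n IH]; first by rewrite !big_ord0 disc0.
by rewrite !big_ord_recr /= discD ?IH// sume_ge0.
Qed.

Lemma measurable_disc : measurable_fun setT (disc l : \bar R -> R).
Proof.
apply: measurable_funM.
  by apply: measurableT_comp => //; apply: measurable_funM.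
apply: (measurableT_comp measurable_natr_bool).
rewrite (_ : (fun h : \bar R => h != +oo%E) = (fun h : \bar R => h < +oo)%E).
  by apply: measurable_fun_lte.
by apply/funext => h; rewrite ltey.
Qed.

Lemma measurable_EFin_expR (c : R) (D : set R) :
  measurable_fun D (fun t : R => (expR (- c * t))%:E).
Proof.
apply: measurable_funTS; apply/measurable_EFinP.
by apply: measurableT_comp => //; apply: measurable_funM.
Qed.

Lemma elaplaceD (F G : R -> \bar R) :
  (forall t, 0 <= t -> (0 <= F t)%E) -> (forall t, 0 <= t -> (0 <= G t)%E) ->
  measurable_fun (`[0, +oo[ : set R) F -> measurable_fun (`[0, +oo[ : set R) G ->
  elaplace l (fun t => F t + G t)%E = (elaplace l F + elaplace l G)%E.
Proof.
move=> F0 G0 mF mG; rewrite /elaplace -ge0_integralD//.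
- apply: eq_integral => t; rewrite inE /= in_itv /= andbT => t0.
  by rewrite ge0_muleDr ?F0 ?G0.
- move=> t; rewrite /= in_itv /= andbT => t0.
  by rewrite mule_ge0 ?F0// lee_fin expR_ge0.
- by apply: emeasurable_funM => //; exact: measurable_EFin_expR.
- move=> t; rewrite /= in_itv /= andbT => t0.
  by rewrite mule_ge0 ?G0// lee_fin expR_ge0.
- by apply: emeasurable_funM => //; exact: measurable_EFin_expR.
Qed.

Lemma eq_elaplace (F G : R -> \bar R) : (forall t, 0 <= t -> F t = G t) ->
  elaplace l F = elaplace l G.
Proof.
move=> FG; apply: eq_integral => t; rewrite inE /= in_itv /= andbT => t0.
by rewrite FG.
Qed.

Lemma elaplace_expR (c Q : R) : 0 <= c -> 0 <= Q ->
  elaplace l (fun t => (c * expR (- Q * t))%:E) = (c / (Q + l))%:E.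
Proof.
move=> c0 Q0.
rewrite (_ : (c / (Q + l))%:E = c%:E * (expR (- (Q + l) * 0) / (Q + l))%:E)%E; last first.
  by rewrite mulr0 expR0 -EFinM mul1r.
rewrite -integral_expR_ray ?ltr_wpDl// -ge0_integralZl_EFin//; last first.
  exact: measurable_EFin_expR.
apply: eq_integral => t _; rewrite -!EFinM; congr EFin.
by rewrite mulrCA -expRD; congr (_ * expR _); ring.
Qed.

Lemma elaplace_cst (c : R) : 0 <= c -> elaplace l (fun=> c%:E) = (c / l)%:E.
Proof.
move=> c0; rewrite -[in RHS](add0r l) -elaplace_expR//.
by apply: eq_elaplace => t _; rewrite oppr0 mul0r expR0 mulr1.
Qed.

(** Integration by parts: a discounted expectation is recovered from the distribution function of
    [J] under the unnormalised weight [W]. *)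
Lemma integral_expectation_disc {d} {T : measurableType d}
    (mu : {sigma_finite_measure set T -> \bar R}) (W : T -> R) (J : T -> \bar R) :
  measurable_fun setT W -> (forall x, 0 <= W x) ->
  measurable_fun setT J -> (forall x, (0 <= J x)%E) ->
  (\int[mu]_x (W x * disc l (J x))%:E)%E =
  (l%:E * elaplace l (fun t => \int[mu]_x (W x * (J x <= t%:E)%E%:R)%:E))%E.
Proof.
move=> mW W0 mJ J0; rewrite elaplace_tonelli//.
rewrite -ge0_integralZl_EFin ?(ltW l0)//; last 2 first.
- by move=> x _; rewrite lee_fin mulr_ge0// ?invr_ge0 ?(ltW l0)// mulr_ge0// disc_ge0.
- apply/measurable_EFinP; apply: measurable_funM => //; apply: measurable_funM => //.
  exact: (measurableT_comp measurable_disc).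
by apply: eq_integral => x _; rewrite -EFinM; congr EFin; field; rewrite gt_eqF.
Qed.

(** The indicators of [H <= t] and [t < H] add up to 1, so the distribution function has transform
    [c / l - c / (Q + l)], and multiplication by [l] gives the value. The case [Q = 0] covers
    infinite holding times. *)
Lemma exponential_disc {d} {T : measurableType d}
    (mu : {sigma_finite_measure set T -> \bar R}) (W : T -> R) (H : T -> \bar R) (c Q : R) :
  measurable_fun setT W -> (forall x, 0 <= W x) ->
  measurable_fun setT H -> (forall x, (0 < H x)%E) -> 0 <= Q ->
  (forall s, 0 <= s ->
     (\int[mu]_x (W x * (s%:E < H x)%E%:R)%:E = (c * expR (- Q * s))%:E)%E) ->
  (\int[mu]_x (W x * disc l (H x))%:E = (c * (Q / (Q + l)))%:E)%E.
Proof.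
move=> mW W0 mH H0 Q0 tailE.
have EW : (\int[mu]_x (W x)%:E = c%:E)%E.
  have := tailE 0 (lexx 0); rewrite mulr0 expR0 mulr1 => <-.
  by apply: eq_integral => x _; rewrite H0 mulr1.
have c0 : 0 <= c.
  by rewrite -lee_fin -EW; apply: integral_ge0 => x _; rewrite lee_fin.
have mb (b : T -> bool) : measurable_fun setT b -> measurable_fun setT (fun x => (W x * (b x)%:R)%:E).
  move=> mb; apply/measurable_EFinP; apply: measurable_funM => //.
  exact: (measurableT_comp measurable_natr_bool).
have H0' x : (0 <= H x)%E by exact: ltW.
have split_ : elaplace l (fun=> c%:E) =
    (elaplace l (fun t => \int[mu]_x (W x * (H x <= t%:E)%E%:R)%:E) +
     elaplace l (fun t => (c * expR (- Q * t))%:E))%E.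
  rewrite -elaplaceD.
  - apply: eq_elaplace => t t0; rewrite -tailE// -ge0_integralD//; last 4 first.
    + by move=> x _; rewrite lee_fin mulr_ge0.
    + by apply: mb; exact: measurable_fun_lee.
    + by move=> x _; rewrite lee_fin mulr_ge0.
    + by apply: mb; exact: measurable_fun_lte.
    rewrite -EW; apply: eq_integral => x _.
    by rewrite -EFinD -mulrDr ltNge; case: (_ <= _)%E; rewrite /= ?addr0 ?add0r mulr1.
  - by move=> t _; apply: integral_ge0 => x _; rewrite lee_fin mulr_ge0.
  - by move=> t _; rewrite lee_fin mulr_ge0// expR_ge0.
  - by apply: measurable_funTS; exact: measurable_tail.
  - apply: measurable_funTS; apply/measurable_EFinP; apply: measurable_funM => //.
    by apply: measurableT_comp => //; apply: measurable_funM.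
rewrite integral_expectation_disc//.
move: split_; rewrite elaplace_cst// elaplace_expR//.
(* [E] is finite: it is a nonnegative summand of the finite number [c / l]. *)
set E := elaplace l _; have : (0 <= E)%E.
  apply: integral_ge0 => t _; rewrite mule_ge0 ?lee_fin ?expR_ge0//.
  by apply: integral_ge0 => x _; rewrite lee_fin mulr_ge0.
case: E => [e||] // _ [ce]; rewrite -EFinM; congr EFin.
have -> : e = c / l - c / (Q + l) by rewrite ce addrK.
by field; rewrite !gt_eqF ?ltr_wpDl.
Qed.

Lemma elaplace_nneseries (F : nat -> R -> \bar R) :
  (forall n t, 0 <= t -> (0 <= F n t)%E) ->
  (forall n, measurable_fun (`[0, +oo[ : set R) (F n)) ->
  elaplace l (fun t => \sum_(n <oo) F n t)%E = (\sum_(n <oo) elaplace l (F n))%E.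
Proof.
move=> F0 mF; rewrite /elaplace -integral_nneseries//.
- apply: eq_integral => t; rewrite inE /= in_itv /= andbT => t0.
  by rewrite nneseriesZl// => n _; exact: F0.
- move=> n; apply: emeasurable_funM; last exact: mF.
  exact: measurable_EFin_expR.
- move=> n t; rewrite /= in_itv /= andbT => t0.
  by rewrite mule_ge0 ?F0// lee_fin expR_ge0.
Qed.

Lemma elaplace_disc {d} {T : measurableType d}
    (mu : {sigma_finite_measure set T -> \bar R}) (W : T -> R) (J : T -> \bar R) (c : R) :
  measurable_fun setT W -> (forall x, 0 <= W x) ->
  measurable_fun setT J -> (forall x, (0 <= J x)%E) ->
  (\int[mu]_x (W x * disc l (J x))%:E = c%:E)%E ->
  elaplace l (fun t => \int[mu]_x (W x * (J x <= t%:E)%E%:R)%:E)%E = (c / l)%:E.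
Proof.
move=> mW W0 mJ J0; rewrite integral_expectation_disc//.
case: (elaplace _ _) => [e||] /=.
- by rewrite -EFinM => -[<-]; congr EFin; field; rewrite gt_eqF.
- by rewrite gt0_muley ?lte_fin.
- by rewrite gt0_muleNy ?lte_fin.
Qed.

(** With [W] the extension of [g] by 0 and [J s = max 0 s], the function [F] is the distribution
    function of [J] under [W]. From here on densities are replaced by distribution functions. *)
Lemma laplace_density (F : R -> \bar R) (g : R -> R) : is_density F g ->
  laplace g l = l * fine (elaplace l F).
Proof.
move=> [mg g0 Fg]; rewrite /laplace /Rintegral.
pose W := g \_ `[0, +oo[.
have mW : measurable_fun setT W by exact/(measurable_restrictT _ _).1.
have W0 x : 0 <= W x.
  by rewrite /W patchE; case: ifPn => //; rewrite inE /= in_itv /= andbT => /g0.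
pose J (s : R) : \bar R := (Num.max 0 s)%:E.
have mJ : measurable_fun setT J.
  by apply/measurable_EFinP; exact: measurable_maxr.
have J0 x : (0 <= J x)%E by rewrite lee_fin le_max lexx.
have -> : elaplace l F = elaplace l (fun t => \int[lebesgue_measure]_x (W x * (J x <= t%:E)%E%:R)%:E)%E.
  apply: eq_elaplace => t t0; rewrite Fg// integral_mkcond; apply: eq_integral => x _.
  rewrite /W !patchE !mem_setE !in_itv /= andbT lee_fin ge_max t0 /=.
  by case: (0 <= x) => /=; case: (x <= t); rewrite ?(mulr1, mulr0, mul0r).
have fineZ (e : \bar R) : l * fine e = fine (l%:E * e)%E.
  case: e => [e||] //=; rewrite mulr0; first by rewrite gt0_muley ?lte_fin.
  by rewrite gt0_muleNy ?lte_fin.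
rewrite fineZ -integral_expectation_disc//; congr fine.
rewrite integral_mkcond; apply: eq_integral => x _.
rewrite /W /J !patchE !mem_setE !in_itv /= andbT /disc /=; case: ifPn => x0.
  by rewrite max_r// mulr1 mulrC.
by rewrite mul0r.
Qed.

End disc_theory.

Lemma probability_bool {d} {T : measurableType d} {R : realType}
    (P : probability T R) (b : T -> bool) : measurable_fun setT b ->
  P [set x | b x] = (\int[P]_x (b x)%:R%:E)%E.
Proof.
move=> mb; have mB : measurable [set x | b x].
  by have := mb measurableT [set true] I; rewrite setTI.
rewrite -[LHS](_ : \int[P]_x (\1_[set x | b x] x)%:E = _)%E; last first.
  by rewrite integral_indic// setIT.
apply: eq_integral => x _; rewrite indicE; congr (nat_of_bool _)%:R%:E.
by apply/idP/idP; rewrite inE.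
Qed.

(** * Chains with finitely many successors *)

Section countable_fibers.
Context {d} {T : measurableType d} {R : realType} {E : countType}.
Variables (Z : T -> E) (mZ : forall e, measurable [set w | Z w = e]).

Lemma measurable_preimage_countable (A : set E) : measurable [set w | A (Z w)].
Proof.
rewrite (_ : [set w | A (Z w)] = \bigcup_(e in A) [set w | Z w = e]).
  rewrite bigcup_mkcond; apply: countable_bigcupT_measurable => // e.
  by case: ifP.
by apply/seteqP; split => [w Aw|w [e Ae /= ->]//]; exists (Z w).
Qed.

Lemma measurable_fun_countable (f : E -> R) : measurable_fun setT (f \o Z).
Proof.
by move=> _ B mB; rewrite setTI; exact: (measurable_preimage_countable [set e | B (f e)]).
Qed.

Lemma measurable_fun_fiber (e : E) : measurable_fun setT (fun w => (Z w == e)%:R : R).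
Proof. exact: (measurable_fun_countable (fun x => (x == e)%:R)). Qed.

(** The part of the integral where [Z] avoids [s] is a countable sum of integrals over fibers, each
    of them 0. This reduces a sum over all states to one over the listed successors. *)
Lemma integral_fibers (mu : {measure set T -> \bar R}) (W : T -> R) (s : seq E) :
  measurable_fun setT W -> (forall x, 0 <= W x) -> uniq s ->
  (forall e, e \notin s -> (\int[mu]_x (W x * (Z x == e)%:R)%:E = 0)%E) ->
  (\int[mu]_x (W x)%:E = \sum_(e <- s) \int[mu]_x (W x * (Z x == e)%:R)%:E)%E.
Proof.
move=> mW W0 us zero.
have mWe e : measurable_fun setT (fun x => (W x * (Z x == e)%:R)%:E).
  by apply/measurable_EFinP; apply: measurable_funM => //; exact: measurable_fun_fiber.
have mR : measurable_fun setT (fun x => (W x * (Z x \notin s)%:R)%:E).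
  apply/measurable_EFinP; apply: measurable_funM => //.
  exact: (measurable_fun_countable (fun x => (x \notin s)%:R)).
transitivity (\int[mu]_x (\sum_(e <- s) (W x * (Z x == e)%:R)%:E
                          + (W x * (Z x \notin s)%:R)%:E))%E.
  apply: eq_integral => x _; rewrite sumEFin -EFinD -mulr_sumr -mulrDr; congr EFin.
  case: (boolP (Z x \in s)) => Zs.
    rewrite addr0 (bigD1_seq (Z x))//= eqxx big1 ?addr0 ?mulr1// => e.
    by rewrite eq_sym => /negbTE ->.
  rewrite big_seq big1 ?add0r ?mulr1// => e es.
  by case: eqP => // Ze; rewrite Ze es in Zs.
rewrite ge0_integralD//; last 3 first.
- by move=> x _; apply: sume_ge0 => e _; rewrite lee_fin mulr_ge0.
- exact: emeasurable_sum.
- by move=> x _; rewrite lee_fin mulr_ge0.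
rewrite ge0_integral_sum//; last by move=> e x _; rewrite lee_fin mulr_ge0.
rewrite [X in (_ + X)%E](_ : _ = 0%E) ?adde0//.
(* The fibers are indexed by their codes in [nat]; a code that is not attained gives the empty
   set. *)
pose F i := [set w | pickle (Z w) = i].
have FT : [set: T] = \bigcup_i F i.
  by apply/seteqP; split => // x _; exists (pickle (Z x)).
rewrite FT ge0_integral_bigcup//.
- rewrite eseries0// => i _ _.
  have [[w0 Fw0]|noF] := pselect (exists w, F i w); last first.
    rewrite (_ : F i = set0) ?integral_set0//.
    by apply/seteqP; split => // w Fw; apply: noF; exists w.
  have FE w : F i w <-> Z w = Z w0.
    rewrite /F /= -Fw0; split => [/(pcan_inj pickleK)//|-> //].
  rewrite integral_mkcond.
  case: (boolP (Z w0 \in s)) => Zs.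
    apply: integral0_eq => x _; rewrite patchE; case: ifPn => //.
    by rewrite inE => /FE ->; rewrite Zs mulr0.
  rewrite -[RHS](zero _ Zs); apply: eq_integral => x _.
  rewrite patchE; case: ifPn.
    by rewrite inE => /FE ->; rewrite Zs eqxx.
  rewrite notin_setE => Fx; case: eqP => [Zx|_]; first by case: Fx; apply/FE.
  by rewrite mulr0.
- by move=> k; exact: (measurable_preimage_countable [set e | pickle e = k]).
- by rewrite -FT.
- by move=> x _; rewrite lee_fin mulr_ge0.
- by apply/trivIsetP => i k _ _ ik; apply/seteqP; split => // x []; rewrite /F /= => -> kE; rewrite kE eqxx in ik.
Qed.

End countable_fibers.

Lemma prod_natr_bool {R : realType} (n : nat) (b : nat -> bool) :
  \prod_(k < n) (b k)%:R = [forall k : 'I_n, b k]%:R :> R.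
Proof.
case: (boolP [forall k : 'I_n, b k]) => [/forallP bT|].
  by rewrite big1// => k _; rewrite bT.
by rewrite negb_forall => /existsP[k /negbTE bk]; rewrite (bigD1 k)//= bk mul0r.
Qed.

Section rates.
Context {R : realType} {E : countType} (q : E -> E -> R) (s : E -> seq E).

(** The list [s i] may contain states of rate 0, for instance when a death rate vanishes; it only
    has to cover the support of the rates out of [i]. *)
Definition finitely_many_successors : Prop :=
  [/\ forall i e, 0 <= q i e, forall i, uniq (s i), forall i, i \notin s i
    & forall i e, e != i -> e \notin s i -> q i e = 0].

(* For constant [h = 1] this is the transition operator of the jump chain killed at
   rate [l] during the holding times. *)
Definition killed_step (l : R) (h f : E -> R) (i : E) : R :=
  h i * \sum_(e <- s i) q i e / (exit_rate q i + l) * f e.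

Hypothesis qs : finitely_many_successors.

Lemma exit_rateE i : exit_rate q i = \sum_(e <- s i) q i e.
Proof.
have [_ us si q0] := qs.
rewrite fsbig_seq// /exit_rate; apply/esym/fsbig_widen => [k /= ks|k [/= ki /negP ks]].
  by apply: contraTneq ks => ->.
exact: q0.
Qed.

Lemma exit_rate_ge0 i : 0 <= exit_rate q i.
Proof. by have [q0 _ _ _] := qs; rewrite exit_rateE sumr_ge0. Qed.

Lemma rate_eq0 i e : exit_rate q i = 0 -> e != i -> q i e = 0.
Proof.
have [q0 us si qn0] := qs; move=> Qi ei; have [es|] := boolP (e \in s i); last exact: qn0.
move: Qi; rewrite exit_rateE => /eqP; rewrite psumr_eq0// => /allP/(_ _ es).
by move/eqP.
Qed.

(** The factor [exit_rate q i / (exit_rate q i + l)] is 0 at an absorbing state and so cancels the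
    self-loop of [jump_prob]. Absorbing states then need no separate treatment. *)
Lemma jump_probE (l : R) i e : 0 < l ->
  exit_rate q i / (exit_rate q i + l) * jump_prob q i e =
  if e == i then 0 else q i e / (exit_rate q i + l).
Proof.
move=> l0; rewrite /jump_prob; have [Qi|Qi] := eqVneq (exit_rate q i) 0.
  by rewrite Qi !mul0r; case: eqVneq => // /rate_eq0 ->; rewrite ?mul0r.
case: ifP => _; first by rewrite mulr0.
have Ql : exit_rate q i + l != 0 by rewrite gt_eqF// ltr_wpDl// exit_rate_ge0.
by field; rewrite Ql Qi.
Qed.

Lemma killed_step_ge0 l h f i : 0 < l -> (forall i, 0 <= h i) ->
  (forall i, 0 <= f i) -> 0 <= killed_step l h f i.
Proof.
move=> l0 h0 f0; have [q0 _ _ _] := qs.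
rewrite mulr_ge0// sumr_ge0// => e _; rewrite mulr_ge0// divr_ge0//.
by rewrite addr_ge0 ?exit_rate_ge0// ltW.
Qed.

Lemma iter_killed_stepZ l h a f n i :
  iter n (killed_step l h) (fun e => a * f e) i = a * iter n (killed_step l h) f i.
Proof.
elim: n i => // n IH i; rewrite !iterS /killed_step mulrCA; congr (_ * _).
by rewrite mulr_sumr; apply: eq_bigr => e _; rewrite IH mulrCA.
Qed.

End rates.

(** * Discounted expectations along the jump chain *)

Section chain.
Context {R : realType} {E : countType} (q : E -> E -> R) (j : E)
  {d : measure_display} {Omega : measurableType d} (P : probability Omega R).
Variables (Y : nat -> Omega -> E) (H : nat -> Omega -> \bar R).
Hypothesis mY : forall k e, measurable [set w | Y k w = e].
Hypothesis mH : forall k, measurable_fun [set: Omega] (H k).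
Hypothesis H0 : forall k w, (0 < H k w)%E.
Hypothesis law : forall (n : nat) (y : nat -> E) (s : nat -> R), (forall k, 0 <= s k) ->
        P [set w | (forall k, (k < n)%N -> Y k w = y k /\ ((s k)%:E < H k w)%E)
                   /\ Y n w = y n]
        = ((y 0%N == j)%:R *
           \prod_(k < n) (expR (- exit_rate q (y k) * s k) *
                          jump_prob q (y k) (y k.+1)))%:E.
Variables (succs : E -> seq E) (qs : finitely_many_successors q succs).
Variables (l : R) (l0 : 0 < l).

Local Notation Q := (exit_rate q).
Local Notation J := (jump_time H).

Let Q0 i : 0 <= Q i.
Proof. exact: exit_rate_ge0 qs i. Qed.

Let prefix n (y : nat -> E) w := [forall k : 'I_n, Y k w == y k].

Let mprefix n y : measurable_fun setT (fun w => (prefix n y w)%:R : R).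
Proof.
rewrite (_ : (fun w => _) = (fun w => \prod_(k < n) (Y k w == y k)%:R)); last first.
  by apply/funext => w; rewrite (prod_natr_bool n (fun k => Y k w == y k)).
by apply: measurable_prod => k _; exact: measurable_fun_fiber.
Qed.

Let factor m (s : nat -> R) k w : R :=
  if (k < m)%N then disc l (H k w) else ((s k)%:E < H k w)%E%:R.

Let factor_ge0 m s k w : 0 <= factor m s k w.
Proof. by rewrite /factor; case: ifP => // _; exact: disc_ge0. Qed.

Let mfactor m s k : measurable_fun setT (factor m s k).
Proof.
rewrite /factor; case: (k < m)%N => /=.
  exact: (measurableT_comp (measurable_disc l)).
apply: (measurableT_comp measurable_natr_bool).
exact: measurable_fun_lte.
Qed.

Let cfactor m (y : nat -> E) (s : nat -> R) k :=
  (if (k < m)%N then Q (y k) / (Q (y k) + l) else expR (- Q (y k) * s k))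
  * jump_prob q (y k) (y k.+1).

(* The indicators [s_k < H_k] of the finite-dimensional laws are replaced by the
   discounts [exp (- l H_k)] one index at a time. *)
Let path_tail m n y s : (forall k, 0 <= s k) ->
  (\int[P]_w ((prefix n.+1 y w)%:R * \prod_(k < n) factor m s k w)%:E =
   ((y 0%N == j)%:R * \prod_(k < n) cfactor m y s k)%:E)%E.
Proof.
elim: m s => [|m IH] s s0.
  rewrite /cfactor /= -law//.
  under eq_integral => w _.
    rewrite /factor /= (prod_natr_bool n (fun k => (s k)%:E < H k w)%E) -natrM mulnb.
    over.
  set A := [set w | _].
  have mA : measurable A.
    rewrite (_ : A = \bigcap_(k in `I_n) ([set w | Y k w = y k] `&` [set w | ((s k)%:E < H k w)%E])
              `&` [set w | Y n w = y n]); last first.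
      by apply/seteqP; split => [w []|w []].
    apply: measurableI => //; apply: bigcap_measurableType => k _.
    apply: measurableI => //; rewrite -[X in measurable X]setTI.
    exact: measurable_lte.
  transitivity (\int[P]_w (\1_A w)%:E)%E; last by rewrite integral_indic// setIT.
  apply: eq_integral => w _; congr EFin; rewrite indicE; congr (nat_of_bool _)%:R.
  apply/idP/idP => [/andP[/forallP p1 /forallP p2]|].
    rewrite inE; split => [k kn|].
      split; last exact: (p2 (Ordinal kn)).
      by apply/eqP; exact: (p1 (widen_ord (leqnSn n) (Ordinal kn))).
    by apply/eqP; exact: (p1 ord_max).
  rewrite inE => -[p1 p2]; apply/andP; split; apply/forallP => k; last first.
    by have [] := p1 k (ltn_ord k).
  have := ltn_ord k; rewrite ltnS leq_eqVlt => /orP[/eqP ->|kn]; first exact/eqP.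
  by apply/eqP; have [] := p1 k kn.
have [mn|nm] := ltnP m n; last first.
  have lt k (kn : (k < n)%N) : ((k < m) = (k < m.+1))%N.
    by rewrite (leq_trans kn nm) ltnS (leq_trans (ltnW kn) nm).
  have -> : \prod_(k < n) cfactor m.+1 y s k = \prod_(k < n) cfactor m y s k.
    by apply: eq_bigr => k _; rewrite /cfactor lt.
  rewrite -IH//; apply: eq_integral => w _; congr (_ * _)%:E.
  by apply: eq_bigr => k _; rewrite /factor lt.
pose im := Ordinal mn.
pose W w := (prefix n.+1 y w)%:R * \prod_(k < n | k != im) factor m s k w.
have ne k (kim : k != im) : ((k < m.+1) = (k < m))%N.
  by rewrite ltnS leq_eqVlt -[m in (_ == m)]/(nat_of_ord im) (inj_eq val_inj) (negbTE kim).
pose c := (y 0%N == j)%:R * (jump_prob q (y m) (y m.+1) * \prod_(k < n | k != im) cfactor m y s k).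
transitivity (\int[P]_w (W w * disc l (H m w))%:E)%E.
  apply: eq_integral => w _; rewrite (bigD1 im)//= /W /factor ltnSn -mulrA; congr (_ * _)%:E.
  by rewrite mulrC; congr (_ * _); apply: eq_bigr => k kim; rewrite ne.
transitivity (c * (Q (y m) / (Q (y m) + l)))%:E; last first.
  rewrite (bigD1 im)//= {1}/cfactor ltnSn /c; congr (_%:E).
  have -> : \prod_(k < n | k != im) cfactor m.+1 y s k = \prod_(k < n | k != im) cfactor m y s k.
    by apply: eq_bigr => k kim; rewrite /cfactor ne.
  by ring.
apply: exponential_disc => //.
- apply: measurable_funM; first exact: mprefix.
  under eq_fun do rewrite -big_filter.
  by apply: measurable_prod => k _; exact: mfactor.
- by move=> w; rewrite mulr_ge0// prodr_ge0.
(* Overwriting the time of index [m] by [t] turns the induction hypothesis into the exponential tail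
   of [H m] under the weight [W]. *)
- move=> t t0; pose s' k := if k == m then t else s k.
  have s'0 k : 0 <= s' k by rewrite /s'; case: ifP.
  have s'E (k : 'I_n) : k != im -> s' k = s k.
    by move=> kim; rewrite /s' -[m in (_ == m)]/(nat_of_ord im) (inj_eq val_inj) (negbTE kim).
  transitivity (\int[P]_w ((prefix n.+1 y w)%:R * \prod_(k < n) factor m s' k w)%:E)%E.
    apply: eq_integral => w _; rewrite [in RHS](bigD1 im)//= /W -mulrA; congr (_ * _)%:E.
    rewrite mulrC; congr (_ * _); first by rewrite /factor ltnn /s' eqxx.
    by apply: eq_bigr => k kim; rewrite /factor s'E.
  rewrite IH//; congr (_%:E); rewrite (bigD1 im)//= {1}/cfactor ltnn /s' eqxx /c.
  have -> : \prod_(k < n | k != im) cfactor m y s' k = \prod_(k < n | k != im) cfactor m y s k.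
    by apply: eq_bigr => k kim; rewrite /cfactor s'E.
  by ring.
Qed.

(** One discounted step: a holding time of parameter [Q i] contributes [Q i / (Q i + l)], followed
    by a jump to [e]. *)
Let K i e := Q i / (Q i + l) * jump_prob q i e.
Let pathw n (y : nat -> E) : R := (y 0%N == j)%:R * \prod_(k < n) K (y k) (y k.+1).

Let J_disc n w : disc l (J n w) = \prod_(k < n) disc l (H k w).
Proof. by rewrite /jump_time (disc_sum l n (fun k => H k w))// => k; exact: ltW. Qed.

Let path_disc n y :
  (\int[P]_w ((prefix n.+1 y w)%:R * disc l (J n w))%:E = (pathw n y)%:E)%E.
Proof.
have := @path_tail n n y (fun=> 0) (fun=> lexx 0).
rewrite (eq_bigr (fun k : 'I_n => K (y k) (y k.+1))); last first.
  by move=> k _; rewrite /cfactor ltn_ord.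
move=> <-; apply: eq_integral => w _; rewrite J_disc; congr (_ * _)%:E.
by apply: eq_bigr => k _; rewrite /factor ltn_ord.
Qed.

Let KE i e : e \in succs i -> K i e = q i e / (Q i + l).
Proof.
have [_ _ si _] := qs; move=> es; rewrite /K (jump_probE _ _ qs)//.
by case: eqVneq es (si i) => // -> ->.
Qed.

Let K_eq0 i e : e \notin succs i -> K i e = 0.
Proof.
have [_ _ _ q0] := qs; move=> es; rewrite /K (jump_probE _ _ qs)//.
by case: eqVneq => // ei; rewrite q0// mul0r.
Qed.

Let J0 n w : (0 <= J n w)%E.
Proof. by apply: sume_ge0 => k _; exact: ltW. Qed.

Let mJ n : measurable_fun setT (J n).
Proof. by apply: emeasurable_sum => k; exact: mH. Qed.

Let discJ_ge0 n w : 0 <= disc l (J n w).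
Proof. exact: disc_ge0. Qed.

Let mdiscJ n : measurable_fun setT (fun w => disc l (J n w)).
Proof. exact: (measurableT_comp (measurable_disc l)). Qed.

Let prefixS n y e w : (prefix n y w)%:R * (Y n w == e)%:R =
  (prefix n.+1 (fun k => if k == n then e else y k) w)%:R :> R.
Proof.
rewrite -natrM mulnb; congr (nat_of_bool _)%:R; apply/andP/forallP => [[/forallP p /eqP <-] k|p].
  case: (eqVneq (k : nat) n) => [-> //|kn].
  have ltkn : (k < n)%N by rewrite ltn_neqAle kn -ltnS ltn_ord.
  exact: (p (Ordinal ltkn)).
split; last by have /= := p ord_max; rewrite eqxx.
apply/forallP => k; have /= := p (widen_ord (leqnSn n) k).
by rewrite ltn_eqF.
Qed.

Let prefix1 y w : prefix 1 y w = (Y 0%N w == y 0%N).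
Proof.
by apply/forallP/idP => [/(_ ord0)//|Y0 k]; rewrite ord1.
Qed.

Let pathwS n y e : pathw n.+1 (fun k => if k == n.+1 then e else y k) = pathw n y * K (y n) e.
Proof.
rewrite /pathw /= big_ord_recr /= eqxx ltn_eqF//= mulrA; congr (_ * _ * _).
apply: eq_bigr => k _.
by rewrite eqSS !ltn_eqF// ltnS ltnW.
Qed.

(** The finite-dimensional laws control [H n] only together with the state [Y n.+1]. The path is
    therefore extended by one state, and the kernel is summed over the successors of [y n]. *)
Lemma path_disc_succ n y :
  (\int[P]_w ((prefix n.+1 y w)%:R * disc l (J n.+1 w))%:E =
   (pathw n y * (Q (y n) / (Q (y n) + l)))%:E)%E.
Proof.
have [_ us _ _] := qs.
have fib e : (\int[P]_w ((prefix n.+1 y w)%:R * disc l (J n.+1 w) * (Y n.+1 w == e)%:R)%:E =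
   (pathw n y * K (y n) e)%:E)%E.
  rewrite -pathwS -path_disc; apply: eq_integral => w _; congr (_%:E).
  by rewrite -prefixS mulrAC.
rewrite (integral_fibers _ (mY n.+1) P _ (succs (y n))) //; last 2 first.
- by move=> w; rewrite mulr_ge0.
- by move=> e es; rewrite fib K_eq0// mulr0.
- under eq_bigr do rewrite fib.
  rewrite sumEFin -mulr_sumr (exit_rateE _ _ qs) mulr_suml; congr (_ * _)%:E.
  by rewrite big_seq [in RHS]big_seq; apply: eq_bigr => e es; rewrite KE// (exit_rateE _ _ qs).
- by apply: measurable_funM => //; exact: mprefix.
Qed.

Section functional.
Variables (h : E -> R) (h0 : forall i, 0 <= h i).
Variables (Phi : nat -> Omega -> R) (phi : E -> R).
Hypothesis mPhi : forall n, measurable_fun setT (Phi n).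
Hypothesis Phi0 : forall n w, 0 <= Phi n w.
Hypothesis PhiE : forall n y,
  (\int[P]_w ((prefix n.+1 y w)%:R * (disc l (J n w) * Phi n w))%:E =
   (pathw n y * phi (y n))%:E)%E.

Let mweight m n : measurable_fun setT (fun w => \prod_(k < n) h (Y (m + k)%N w)).
Proof. by apply: measurable_prod => k _; exact: measurable_fun_countable. Qed.

Let weight0 m n w : 0 <= \prod_(k < n) h (Y (m + k)%N w).
Proof. by rewrite prodr_ge0. Qed.

(* Induction on the number of steps after time [m], splitting over the value of
   [Y (m + 1)]: only the law of finite paths is needed. *)
Let front_peeling n m y :
  (\int[P]_w ((prefix m.+1 y w)%:R *
     (\prod_(k < n) h (Y (m + k)%N w) * (disc l (J (m + n)%N w) * Phi (m + n)%N w)))%:E =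
   (pathw m y * iter n (killed_step q succs l h) phi (y m))%:E)%E.
Proof.
have [_ us _ _] := qs.
elim: n m y => [|n IH] m y.
  by rewrite -PhiE addn0; apply: eq_integral => w _; rewrite big_ord0 mul1r.
pose W w := (prefix m.+1 y w)%:R *
  (\prod_(k < n.+1) h (Y (m + k)%N w) * (disc l (J (m + n.+1)%N w) * Phi (m + n.+1)%N w)).
change (\int[P]_w (W w)%:E =
  (pathw m y * iter n.+1 (killed_step q succs l h) phi (y m))%:E)%E.
have W0 w : 0 <= W w by rewrite !mulr_ge0.
have mW : measurable_fun setT W.
  by apply: measurable_funM; [exact: mprefix|do 2 apply: measurable_funM => //].
have fib e : (\int[P]_w (W w * (Y m.+1 w == e)%:R)%:E =
    (h (y m) * (pathw m y * K (y m) e * iter n (killed_step q succs l h) phi e))%:E)%E.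
  (* Fixing [Y m.+1 = e] extends the prefix by one state, so the induction hypothesis applies from
     time [m.+1]; the weight left over is [h (y m)]. *)
  have := IH m.+1 (fun k => if k == m.+1 then e else y k).
  rewrite pathwS eqxx => fibE; rewrite EFinM -fibE.
  rewrite -ge0_integralZl_EFin//; last 2 first.
  - by move=> w _; rewrite lee_fin !mulr_ge0.
  - apply/measurable_EFinP; apply: measurable_funM; first exact: mprefix.
    by do 2 apply: measurable_funM => //.
  apply: eq_integral => w _; rewrite -EFinM; congr (_%:E).
  rewrite -prefixS /W big_ord_recl /= addn0.
  under eq_bigr do rewrite /bump /= add1n addnS -addSn.
  rewrite -addSnnS.
  have [/forallP pre|_] := boolP (prefix m.+1 y w); last by rewrite !mul0r mulr0.
  by have /eqP -> := pre ord_max; rewrite /=; ring.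
rewrite (integral_fibers _ (mY m.+1) P _ _ mW W0 (us (y m))); last first.
  by move=> e es; rewrite fib K_eq0// !(mulr0, mul0r).
under eq_bigr do rewrite fib.
rewrite sumEFin iterS; congr (_%:E).
rewrite [RHS](_ : _ = pathw m y * (h (y m) * \sum_(e <- succs (y m))
  q (y m) e / (Q (y m) + l) * iter n (killed_step q succs l h) phi e))//.
rewrite !mulr_sumr big_seq [in RHS]big_seq; apply: eq_bigr => e es.
by rewrite KE//; ring.
Qed.

(** [Phi] is kept abstract because it is needed both as a function of [Y n] alone and with an
    additional discount over the holding time [H n]. Splitting over [Y 0] leaves only the initial
    state [j]. *)
Lemma expectation_disc n :
  (\int[P]_w (\prod_(k < n) h (Y k w) * (disc l (J n w) * Phi n w))%:E =
   (iter n (killed_step q succs l h) phi j)%:E)%E.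
Proof.
have fib e : (\int[P]_w (\prod_(k < n) h (Y k w) * (disc l (J n w) * Phi n w) *
    (Y 0%N w == e)%:R)%:E = ((e == j)%:R * iter n (killed_step q succs l h) phi e)%:E)%E.
  have := @front_peeling n 0%N (fun=> e); rewrite /pathw big_ord0 mulr1 => <-.
  by apply: eq_integral => w _; congr (_%:E); rewrite mulrC prefix1.
rewrite (integral_fibers _ (mY 0%N) P _ [:: j]) //.
- by rewrite big_seq1 fib eqxx mul1r.
- apply: measurable_funM; first exact: (mweight 0).
  exact: measurable_funM.
- by move=> w; rewrite !mulr_ge0// (weight0 0).
- by move=> e ej; rewrite fib; move: ej; rewrite inE => /negbTE ->; rewrite mul0r.
Qed.

End functional.

Lemma expectation_disc_fun (h f : E -> R) n :
  (forall i, 0 <= h i) -> (forall i, 0 <= f i) ->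
  (\int[P]_w (\prod_(k < n) h (Y k w) * f (Y n w) * disc l (J n w))%:E =
   (iter n (killed_step q succs l h) f j)%:E)%E.
Proof.
move=> h0 f0.
rewrite -(expectation_disc h h0 (fun n w => f (Y n w))); last 3 first.
- by move=> k; exact: measurable_fun_countable.
- by move=> k w.
- move=> k y; rewrite mulrC EFinM -path_disc -ge0_integralZl_EFin//; last 2 first.
  + by move=> w _; rewrite lee_fin mulr_ge0.
  + by apply/measurable_EFinP; apply: measurable_funM => //; exact: mprefix.
  apply: eq_integral => w _; rewrite -EFinM; congr (_%:E).
  have [/forallP/(_ ord_max)/= /eqP ->|_] := boolP (prefix k.+1 y w); first by ring.
  by rewrite !mul0r mulr0.
by apply: eq_integral => w _; rewrite -mulrA; congr (_ * _)%:E; rewrite mulrC.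
Qed.

Lemma expectation_disc_fun_succ (h f : E -> R) n :
  (forall i, 0 <= h i) -> (forall i, 0 <= f i) ->
  (\int[P]_w (\prod_(k < n) h (Y k w) * f (Y n w) * disc l (J n.+1 w))%:E =
   (iter n (killed_step q succs l h) (fun i => Q i / (Q i + l) * f i) j)%:E)%E.
Proof.
move=> h0 f0.
rewrite -(expectation_disc h h0 (fun n w => f (Y n w) * disc l (H n w))); last 3 first.
- move=> k; apply: measurable_funM; first exact: measurable_fun_countable.
  exact: (measurableT_comp (measurable_disc l)).
- by move=> k w; rewrite mulr_ge0// disc_ge0.
- move=> k y; rewrite mulrA mulrC EFinM -path_disc_succ -ge0_integralZl_EFin//; last 2 first.
  + by move=> w _; rewrite lee_fin mulr_ge0.
  + by apply/measurable_EFinP; apply: measurable_funM => //; exact: mprefix.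
  apply: eq_integral => w _; rewrite -EFinM; congr (_%:E).
  rewrite !J_disc big_ord_recr /=.
  have [/forallP/(_ ord_max)/= /eqP ->|_] := boolP (prefix k.+1 y w); first by ring.
  by rewrite !mul0r mulr0.
by apply: eq_integral => w _; rewrite !J_disc big_ord_recr /=; congr (_%:E); ring.
Qed.

(** * Laws at fixed times, hitting times and non-explosion *)

Variables (X : R -> Omega -> option E).
Hypothesis hX : forall (t : R) w e, 0 <= t ->
        (X t w = Some e <->
         exists n, Y n w = e /\
           (jump_time H n w <= t%:E < jump_time H n.+1 w)%E).

Let JS n w : J n.+1 w = (J n w + H n w)%E.
Proof. by rewrite /jump_time big_ord_recr. Qed.

Let J_nondecreasing w m n : (m <= n)%N -> (J m w <= J n w)%E.
Proof.
elim: n => [|n IH]; first by rewrite leqn0 => /eqP ->.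
rewrite leq_eqVlt => /orP[/eqP -> //|mn]; apply: (le_trans (IH mn)).
by rewrite JS leeDl// ltW.
Qed.

Let mJle n (t : R) : measurable_fun setT (fun w => (J n w <= t%:E)%E).
Proof. exact: measurable_fun_lee. Qed.

Let mJlt n (t : R) : measurable_fun setT (fun w => (t%:E < J n w)%E).
Proof. exact: measurable_fun_lte. Qed.

Let mYeq n e : measurable_fun setT (fun w => Y n w == e).
Proof.
apply: (measurable_fun_bool true); rewrite setTI.
rewrite (_ : _ @^-1` _ = [set w | Y n w = e])//.
by apply/seteqP; split => w /= /eqP.
Qed.

Let slice t e n w := (Y n w == e) && (J n w <= t%:E < J n.+1 w)%E.

Let mslice t e n : measurable_fun setT (slice t e n).
Proof. by apply: measurable_and => //; apply: measurable_and. Qed.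

Let mslice_set t e n : measurable [set w | slice t e n w].
Proof. by have := mslice t e n measurableT [set true] I; rewrite setTI. Qed.

Let at_timeE t e : 0 <= t ->
  [set w | X t w = Some e] = \bigcup_n [set w | slice t e n w].
Proof.
move=> t0; apply/seteqP; split => [w /= /hX-/(_ t0)[n [Yn Jn]]|w [n _ /andP[/eqP Yn Jn]] /=].
  by exists n => //; rewrite /slice /= Yn eqxx.
by apply/hX => //; exists n.
Qed.

Lemma measurable_at_time t e : 0 <= t -> measurable [set w | X t w = Some e].
Proof. by move=> t0; rewrite at_timeE//; exact: bigcup_measurable. Qed.

(** The intervals from [J n] to [J n.+1] are disjoint because [J] is nondecreasing in [n]. *)
Lemma law_at_time t e : 0 <= t ->
  P [set w | X t w = Some e] =
  (\sum_(n <oo) \int[P]_w ((Y n w == e)%:R * (J n w <= t%:E < J n.+1 w)%E%:R)%:E)%E.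
Proof.
move=> t0; rewrite at_timeE// measure_bigcup//; last first.
  move=> m n _ _ [w [/andP[_ /andP[m1 m2]] /andP[_ /andP[n1 n2]]]].
  have [mn|nm|//] := ltngtP m n.
    by have := lt_le_trans m2 (J_nondecreasing w _ _ mn); rewrite ltNge n1.
  by have := lt_le_trans n2 (J_nondecreasing w _ _ nm); rewrite ltNge m1.
rewrite (eq_eseriesl (Q := xpredT)); last by move=> n; rewrite in_setT.
apply: eq_eseriesr => n _.
apply: etrans (probability_bool P (slice t e n) (mslice t e n)) _; apply: eq_integral => w _.
by rewrite /slice -mulnb natrM.
Qed.

(** The indicator of [J n <= t < J n.+1] is the difference of those of [J n <= t] and [J n.+1 <= t].
    On [Y n = e] their transforms are [a / l] and [Q e / (Q e + l) * a / l], where [a] is the [n]-th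
    iterate at [j]; the difference is [a / (Q e + l)]. *)
Lemma elaplace_law_at_time e :
  elaplace l (fun t => P [set w | X t w = Some e]) =
  (\sum_(n <oo) (iter n (killed_step q succs l (fun=> 1)) (fun i => (i == e)%:R) j /
                 (Q e + l))%:E)%E.
Proof.
rewrite (eq_elaplace _ _ _ (fun t t0 => law_at_time t e t0)).
pose A n m t := (\int[P]_w ((Y n w == e)%:R * (J m w <= t%:E)%E%:R)%:E)%E.
pose B n t := (\int[P]_w ((Y n w == e)%:R * (J n w <= t%:E < J n.+1 w)%E%:R)%:E)%E.
have mYr n : measurable_fun setT (fun w => (Y n w == e)%:R : R).
  exact: measurable_fun_fiber.
have A0 n m t : (0 <= A n m t)%E by apply: integral_ge0 => w _; rewrite lee_fin mulr_ge0.
have B0 n t : (0 <= B n t)%E by apply: integral_ge0 => w _; rewrite lee_fin mulr_ge0.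
have mA n m : measurable_fun setT (A n m) by apply: measurable_tail.
have ABE n t : A n n t = (B n t + A n n.+1 t)%E.
  rewrite -ge0_integralD; last 5 first.
  - by [].
  - by move=> w _; rewrite lee_fin mulr_ge0.
  - apply/measurable_EFinP; apply: measurable_funM => //.
    apply: (measurableT_comp measurable_natr_bool).
    exact: measurable_and.
  - by move=> w _; rewrite lee_fin mulr_ge0.
  - apply/measurable_EFinP; apply: measurable_funM => //.
    exact: (measurableT_comp measurable_natr_bool).
  apply: eq_integral => w _; rewrite -EFinD -mulrDr; congr (_ * _)%:E.
  rewrite ltNge; have [Jt|] := boolP (J n.+1 w <= t%:E)%E.
    by rewrite andbF add0r (le_trans (J_nondecreasing w _ _ (leqnSn n)) Jt).
  by rewrite andbT addr0.
(* Finiteness allows [B n] to be written as a difference, from which its measurability follows. *)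
have A_fin n m t : A n m t \is a fin_num.
  rewrite ge0_fin_numE//; apply: (@le_lt_trans _ _ (\int[P]_w 1)%E).
    apply: ge0_le_integral.
    - by [].
    - by move=> w _; rewrite lee_fin mulr_ge0.
    - apply/measurable_EFinP; apply: measurable_funM => //.
      exact: (measurableT_comp measurable_natr_bool).
    - by [].
    - by move=> w _; rewrite lee_fin -natrM mulnb lern1 leq_b1.
  by rewrite integral_cst//= mul1e; exact: le_lt_trans (probability_le1 P measurableT) (ltry 1).
have BE n : B n = (fun t => A n n t - A n n.+1 t)%E.
  by apply/funext => t; rewrite ABE addeK.
have mB n : measurable_fun setT (B n).
  by rewrite BE; apply: emeasurable_funB.
have ellA n : elaplace l (A n n) = (iter n (killed_step q succs l (fun=> 1)) (fun i => (i == e)%:R) j / l)%:E.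
  apply: elaplace_disc => //.
  by rewrite -expectation_disc_fun//; apply: eq_integral => w _; rewrite big1// mul1r.
have ellA' n : elaplace l (A n n.+1) = (Q e / (Q e + l) *
    iter n (killed_step q succs l (fun=> 1)) (fun i => (i == e)%:R) j / l)%:E.
  apply: elaplace_disc => //.
  rewrite -iter_killed_stepZ.
  have -> : (fun i => Q e / (Q e + l) * (i == e)%:R) = (fun i => Q i / (Q i + l) * (i == e)%:R).
    by apply/funext => i; case: eqP => [-> //|_]; rewrite !mulr0.
  by rewrite -expectation_disc_fun_succ//; apply: eq_integral => w _; rewrite big1// mul1r.
rewrite (elaplace_nneseries _ B (fun n t _ => B0 n t)); last by move=> n; exact: measurable_funTS.
apply: eq_eseriesr => n _.
have : elaplace l (A n n) = (elaplace l (B n) + elaplace l (A n n.+1))%E.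
  rewrite -elaplaceD//; [|exact: measurable_funTS..].
  by apply: eq_elaplace => t _; exact: ABE.
rewrite ellA ellA'; case: (elaplace l (B n)) => // b [bE]; congr EFin.
set a := iter _ _ _ _ in bE *.
have Ql : Q e + l != 0 by rewrite gt_eqF// ltr_wpDl.
have l_neq0 : l != 0 by rewrite gt_eqF.
have -> : b = a / l - Q e / (Q e + l) * a / l by rewrite bE addrK.
by field; rewrite l_neq0 Ql.
Qed.

Let J_fin_num n w t : (J n w <= t%:E)%E -> J n w = (fine (J n w))%:E.
Proof.
by move=> Jt; rewrite fineK// ge0_fin_numE// (le_lt_trans Jt)// ltry.
Qed.

Let first_visit e n w := [forall k : 'I_n, Y k w != e] && (Y n w == e).

(** The infimum is attained at the jump time of the first visit: the path is in [e] at that time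
    because holding times are positive, and every other time spent in [e] belongs to a visit of
    larger or equal index. Without a visit the infimum is [+oo]. *)
Lemma hitting_timeP e w t :
  (hitting_time X e w <= t%:E)%E <->
  exists2 n, first_visit e n w & (J n w <= t%:E)%E.
Proof.
split => [ht|[n /andP[_ /eqP Yn] Jt]]; last first.
  apply: le_trans (Jt); rewrite (J_fin_num _ _ _ Jt).
  apply: ereal_inf_lbound; exists (fine (J n w)) => //.
  have J0' : 0 <= fine (J n w) by rewrite fine_ge0.
  split => //; apply/hX => //; exists n; split=> //.
  by rewrite JS -(J_fin_num _ _ _ Jt) lexx /= lteDl// fin_numE (J_fin_num _ _ _ Jt).
have [[n Yn]|noY] := pselect (exists n, Y n w == e); last first.
  move: ht; rewrite leNgt => /negP; case; apply: lt_le_trans (ltry t) _.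
  apply: le_ereal_inf_tmp => _ [u [u0 /hX-/(_ u0)[m [Ym _]]] <-].
  by case: noY; exists m; apply/eqP.
have exY : exists n, Y n w == e by exists n.
case: (ex_minnP exY) => m /eqP Ym mmin; exists m.
  rewrite /first_visit Ym eqxx andbT; apply/forallP => k; apply/negP => Yk.
  by have := mmin _ Yk; rewrite leqNgt ltn_ord.
apply: le_trans ht; apply: le_ereal_inf_tmp => _ [u [u0 /hX-/(_ u0)[p [Yp /andP[Jp _]]]] <-].
by apply: le_trans Jp; apply: J_nondecreasing; apply: mmin; apply/eqP.
Qed.

(** The weight [(i != e)%:R] stops the chain once it has reached [e], so the [n]-th term counts only
    first visits at step [n]. These events are disjoint for distinct [n]. *)
Lemma elaplace_hitting_time e :
  elaplace l (fun t => P [set w | (hitting_time X e w <= t%:E)%E]) =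
  (\sum_(n <oo) (iter n (killed_step q succs l (fun i => (i != e)%:R))
                   (fun i => (i == e)%:R) j / l)%:E)%E.
Proof.
pose W n w : R := \prod_(k < n) (Y k w != e)%:R * (Y n w == e)%:R.
have WE n w : W n w = (first_visit e n w)%:R.
  by rewrite /W (prod_natr_bool n (fun k => Y k w != e)) -natrM mulnb.
have mfv n : measurable_fun setT (first_visit e n).
  apply: measurable_and => //.
  apply: (measurable_fun_bool true); rewrite setTI.
  rewrite [X in measurable X](_ : _ = \bigcap_(k in `I_n) [set w | Y k w != e]); last first.
    apply/seteqP; split => [w /= /forallP Yk k kn|w Yk]; first exact: (Yk (Ordinal kn)).
    by apply/forallP => k; exact: (Yk k (ltn_ord k)).
  apply: bigcap_measurableType => k _.
  exact: (measurable_preimage_countable (Y k) (mY k) [set i | i != e]).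
have mW n : measurable_fun setT (W n).
  rewrite (_ : W n = (fun w => (first_visit e n w)%:R)); last exact/funext/WE.
  exact: (measurableT_comp measurable_natr_bool).
have W0 n w : 0 <= W n w by rewrite WE.
rewrite (eq_elaplace _ _ (fun t => \sum_(n <oo) \int[P]_w (W n w * (J n w <= t%:E)%E%:R)%:E)%E); last first.
  move=> t t0.
  pose A n := [set w | first_visit e n w && (J n w <= t%:E)%E].
  have mb n : measurable_fun setT (fun w => first_visit e n w && (J n w <= t%:E)%E).
    exact: measurable_and.
  have -> : [set w | (hitting_time X e w <= t%:E)%E] = \bigcup_n A n.
    apply/seteqP; split => [w /= /hitting_timeP[n fv Jn]|w [n _ /andP[fv Jn]] /=].
      by exists n => //; rewrite /A /= fv.
    by apply/hitting_timeP; exists n.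
  rewrite measure_bigcup//; last 2 first.
  - by move=> n _; have := mb n measurableT [set true] I; rewrite setTI.
  - move=> m n _ _ [w [/andP[/andP[/forallP m1 m2] _] /andP[/andP[/forallP n1 n2] _]]].
    have [mn|nm|//] := ltngtP m n.
      by have := n1 (Ordinal mn); rewrite m2.
    by have := m1 (Ordinal nm); rewrite n2.
  rewrite (eq_eseriesl (Q := xpredT)); last by move=> n; rewrite in_setT.
  apply: eq_eseriesr => n _.
  apply: etrans (probability_bool P _ (mb n)) _; apply: eq_integral => w _.
  by rewrite WE -mulnb natrM.
rewrite elaplace_nneseries//; last 2 first.
- by move=> n t _; apply: integral_ge0 => w _; rewrite lee_fin mulr_ge0.
- by move=> n; apply: measurable_funTS; exact: measurable_tail.
apply: eq_eseriesr => n _; apply: elaplace_disc => //.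
by rewrite -expectation_disc_fun.
Qed.

(** The iterate is the expectation of [disc l (J n)], at most [P (J n <= t) + expR (- l * t)] for
    each [t >= 0]. Non-explosion at time [t] makes the first term tend to 0, and then [t] may be
    taken large. *)
Lemma nonexplosive_killed_step :
  (forall t, 0 <= t -> (1 <= P (\bigcup_e [set w | X t w = Some e]))%E) ->
  iter n (killed_step q succs l (fun=> 1)) (fun=> 1) j @[n --> \oo] --> 0.
Proof.
move=> nonexpl.
pose a n := iter n (killed_step q succs l (fun=> 1)) (fun=> 1) j.
have aE n : (a n)%:E = (\int[P]_w (disc l (J n w))%:E)%E.
  by rewrite -expectation_disc_fun//; apply: eq_integral => w _; rewrite big1// !mul1r.
have mset n (t : R) : measurable [set w | (t%:E < J n w)%E].
  by rewrite -[X in measurable X]setTI; exact: measurable_lte.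
have bound n t : 0 <= t -> ((a n)%:E <= P [set w | (J n w <= t%:E)%E] + (expR (- l * t))%:E)%E.
  move=> t0; rewrite aE (probability_bool P _ (mJle n t)).
  have -> : ((expR (- l * t))%:E = \int[P]_w (expR (- l * t))%:E :> \bar R)%E.
    by rewrite integral_cst//= [X in (_ * X)%E]probability_setT mule1.
  rewrite -ge0_integralD//; last first.
    by apply/measurable_EFinP; exact: (measurableT_comp measurable_natr_bool).
  apply: ge0_le_integral.
  - by [].
  - by move=> w _; rewrite lee_fin.
  - by apply/measurable_EFinP; exact: mdiscJ.
  - apply: emeasurable_funD => //; apply/measurable_EFinP.
    exact: (measurableT_comp measurable_natr_bool).
  - move=> w _; rewrite -EFinD lee_fin.
    have [Jt|] := boolP (J n w <= t%:E)%E.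
      by rewrite (le_trans (disc_le1 _ l0 _ (J0 n w)))// lerDl expR_ge0.
    rewrite -ltNge add0r; case: (J n w) => [x||] //=.
      by rewrite lte_fin /disc /= mulr1 ler_expR => tx; rewrite !mulNr lerN2 ler_pM2l// ltW.
    by rewrite /disc eqxx mulr0 expR_ge0.
have a0 n : 0 <= a n.
  by rewrite -lee_fin aE; apply: integral_ge0 => w _; rewrite lee_fin.
apply/cvgrPdist_le => eps eps0.
(* Solves [expR (- l * t) <= eps / 2]; the maximum with 0 is there because non-explosion is given
   for nonnegative times. *)
pose t := Num.max 0 (- ln (eps / 2) / l).
have t0 : 0 <= t by rewrite le_max lexx.
have et : expR (- l * t) <= eps / 2.
  rewrite -[leRHS]lnK ?posrE ?divr_gt0// ler_expR mulNr lerNl -ler_pdivrMl// mulrC.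
  by rewrite le_max lexx orbT.
have cvJ : P [set w | (t%:E < J n w)%E] @[n --> \oo] --> 1%E.
  have -> : 1%E = P (\bigcup_n [set w | (t%:E < J n w)%E]).
    apply/eqP; rewrite eq_le probability_le1 ?andbT; last exact: bigcup_measurable.
    apply: (le_trans (nonexpl _ t0)); apply: le_measure; rewrite ?inE.
    - by apply: countable_bigcupT_measurable => // e; exact: measurable_at_time.
    - exact: bigcup_measurable.
    - by move=> w [e _ /hX-/(_ t0)[n [_ /andP[_ Jn]]]]; exists n.+1.
  apply: nondecreasing_cvg_mu => //; first exact: bigcup_measurable.
  move=> m n mn; apply/subsetPset => w /= tJ.
  exact: (lt_le_trans tJ (J_nondecreasing w _ _ mn)).
have /fine_cvgP[_ /cvgrPdist_le/(_ (eps / 2))] := cvJ.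
rewrite divr_gt0// => /(_ isT); apply: filterS => n /=.
have PC : P [set w | (J n w <= t%:E)%E] = (1 - P [set w | (t%:E < J n w)%E])%E.
  rewrite -probability_setC//; congr (P _); apply/seteqP; split => w /=.
    by move=> Jt; rewrite ltNge Jt.
  by move/negP; rewrite -leNgt.
have Pfin : P [set w | (t%:E < J n w)%E] \is a fin_num by exact: fin_num_measure.
have := bound n _ t0; rewrite PC -(fineK Pfin) -EFinB -EFinD lee_fin => bnd /ler_normlP[_ dist].
rewrite sub0r normrN ger0_norm; last exact: a0.
by rewrite -[leLHS]/(a n); apply: (le_trans bnd); rewrite [leRHS]splitr lerD.
Qed.

End chain.

(** * Potentials *)

Section potential.
Context {R : realType} {E : countType} (q : E -> E -> R) (s : E -> seq E).
Hypothesis qs : finitely_many_successors q s.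
Variables (l : R) (l0 : 0 < l) (h : E -> R) (h0 : forall i, 0 <= h i).

Local Notation L := (killed_step q s l h).

Lemma killed_step_sum n (F : nat -> E -> R) i :
  L (fun e => \sum_(k < n) F k e) i = \sum_(k < n) L (F k) i.
Proof.
rewrite /killed_step -mulr_sumr; congr (_ * _); rewrite exchange_big /=.
by apply: eq_bigr => e _; rewrite mulr_sumr.
Qed.

Lemma le_killed_step (f g : E -> R) i :
  (forall e, f e <= g e) -> L f i <= L g i.
Proof.
move=> fg; have [q0 _ _ _] := qs.
rewrite ler_wpM2l// ler_sum// => e _; rewrite ler_wpM2l// divr_ge0//.
by rewrite addr_ge0 ?(exit_rate_ge0 _ _ qs)// ltW.
Qed.

Lemma cvg_killed_step (F : nat -> E -> R) (f : E -> R) i :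
  (forall e, F n e @[n --> \oo] --> f e) -> L (F n) i @[n --> \oo] --> L f i.
Proof.
move=> Ff; apply: cvgMr; elim: (s i) => [|e t IH].
  by under eq_fun do rewrite big_nil; rewrite big_nil; exact: cvg_cst.
under eq_fun do rewrite big_cons; rewrite big_cons.
by apply: cvgD => //; exact: cvgMr.
Qed.

(** The Green function of the killed chain applied to [f]. The value of [limn] is meaningful once
    the partial sums are bounded, which a supersolution ensures. *)
Definition potential (f : E -> R) (i : E) : R :=
  limn (fun n => \sum_(k < n) iter k L f i).

Lemma potential_sumS (f : E -> R) n i :
  \sum_(k < n.+1) iter k L f i = f i + L (fun e => \sum_(k < n) iter k L f e) i.
Proof. by rewrite big_ord_recl killed_step_sum. Qed.

(* [f + L g <= g] makes [g] a supersolution of the equation solved by the potential. *)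
Lemma potential_spec (f g : E -> R) :
  (forall i, 0 <= f i) -> (forall i, f i + L g i <= g i) -> (forall i, 0 <= g i) ->
  [/\ forall i, (\sum_(n <oo) (iter n L f i)%:E = (potential f i)%:E)%E,
      forall i, potential f i = f i + L (potential f) i
    & forall i, 0 <= potential f i <= g i].
Proof.
move=> f0 fLg g0.
have it0 k i : 0 <= iter k L f i.
  by elim: k i => [//|k IH] i; rewrite iterS killed_step_ge0.
have Sg n i : \sum_(k < n) iter k L f i <= g i.
  elim: n i => [|n IH] i; first by rewrite big_ord0.
  by rewrite potential_sumS (le_trans _ (fLg i))// lerD2l le_killed_step.
have nd i : nondecreasing_seq (fun n => \sum_(k < n) iter k L f i).
  by apply/nondecreasing_seqP => n; rewrite big_ord_recr lerDl.
have cv i : \sum_(k < n) iter k L f i @[n --> \oo] --> potential f i.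
  apply: nondecreasing_is_cvgn; first exact: nd.
  by exists (g i) => _ [n _ <-]; exact: Sg.
split=> // i.
- apply/cvg_lim => //.
  rewrite (_ : (fun n => _) = EFin \o (fun n => \sum_(k < n) iter k L f i)).
    by apply: cvg_EFin; [exact: nearW|exact: cv].
  by apply/funext => n; rewrite /= sumEFin big_mkord.
- rewrite {1}/potential; apply/cvg_lim => //.
  rewrite -cvg_shiftS /=; under eq_fun do rewrite potential_sumS.
  by apply: cvgD; [exact: cvg_cst|exact: cvg_killed_step].
- apply/andP; split; [apply: limr_ge|apply: limr_le]; try by apply: cvgP (cv i).
    by apply: nearW => n; rewrite sumr_ge0.
  by apply: nearW.
Qed.

(** The rates out of [i] sum to [exit_rate q i], so one step loses the fraction
    [l / (exit_rate q i + l)]. This makes constants available as supersolutions. *)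
Lemma killed_step_cst (c : R) i :
  L (fun=> c) i = h i * c * (1 - l / (exit_rate q i + l)).
Proof.
rewrite /killed_step -mulr_suml -mulr_suml -(exit_rateE _ _ qs) -[RHS]mulrA; congr (_ * _).
rewrite mulrC; congr (_ * _).
by field; rewrite gt_eqF// ltr_wpDl// (exit_rate_ge0 _ _ qs).
Qed.

End potential.

(** * Transforms of transition probabilities and hitting times as potentials *)

Section markov.
Context {R : realType} {E : countType} (q : E -> E -> R) (s : E -> seq E).
Hypothesis qs : finitely_many_successors q s.
Variables (l : R) (l0 : 0 < l).

(** Expected discounted number of visits to [e]. A visit has mean discounted duration
    [1 / (exit_rate q e + l)], hence the quotient in [elaplace_law]. *)
Definition occupation (e : E) : E -> R :=
  potential q s l (fun=> 1) (fun i => (i == e)%:R).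

(** Expectation of [exp (- l T)] for the hitting time [T] of [e], with value 0 on [T = +oo]. *)
Definition hitting (e : E) : E -> R :=
  potential q s l (fun i => (i != e)%:R) (fun i => (i == e)%:R).

Let Ql i : 0 < exit_rate q i + l.
Proof. by rewrite ltr_wpDl// (exit_rate_ge0 _ _ qs). Qed.

Let occupation_spec e := potential_spec q s qs l l0 (fun=> 1) (fun=> ler01)
  (fun i => (i == e)%:R) (fun=> (exit_rate q e + l) / l).

(** One killed step lowers this constant by [(exit_rate q e + l) / (exit_rate q i + l)], which is
    exactly the source 1 at [i = e]. *)
Let occupation_super e i : (i == e)%:R +
  killed_step q s l (fun=> 1) (fun=> (exit_rate q e + l) / l) i <= (exit_rate q e + l) / l.
Proof.
have lQ0 : 0 < (exit_rate q e + l) / l by rewrite divr_gt0.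
rewrite (killed_step_cst q s qs)// mul1r mulrBr mulr1 addrCA gerDl subr_le0.
case: eqP => [->|_]; last by rewrite mulr_ge0 ?divr_ge0// ltW.
by rewrite mulrA divfK ?divff ?gt_eqF.
Qed.

Let lQ_ge0 e (i : E) : 0 <= (exit_rate q e + l) / l.
Proof. by rewrite divr_ge0// ltW. Qed.

Lemma occupationE e i : occupation e i =
  (i == e)%:R + killed_step q s l (fun=> 1) (occupation e) i.
Proof. by have [_ spec _] := occupation_spec e (fun=> ler0n _ _) (occupation_super e) (lQ_ge0 e); exact: spec. Qed.

Lemma occupation_bound e i : 0 <= occupation e i <= (exit_rate q e + l) / l.
Proof. by have [_ _ spec] := occupation_spec e (fun=> ler0n _ _) (occupation_super e) (lQ_ge0 e); exact: spec. Qed.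

Let hitting_spec e := potential_spec q s qs l l0 (fun i => (i != e)%:R) (fun=> ler0n _ _)
  (fun i => (i == e)%:R) (fun=> 1).

Let hitting_super e i : (i == e)%:R +
  killed_step q s l (fun i => (i != e)%:R) (fun=> 1) i <= 1.
Proof.
rewrite (killed_step_cst q s qs)//; case: eqP => _ /=; first by rewrite !mul0r addr0.
by rewrite add0r !mul1r gerBl divr_ge0// ltW.
Qed.

Lemma hittingE e i : hitting e i =
  (i == e)%:R + killed_step q s l (fun i => (i != e)%:R) (hitting e) i.
Proof. by have [_ spec _] := hitting_spec e (fun=> ler0n _ _) (hitting_super e) (fun=> ler01); exact: spec. Qed.

Lemma hitting_bound e i : 0 <= hitting e i <= 1.
Proof. by have [_ _ spec] := hitting_spec e (fun=> ler0n _ _) (hitting_super e) (fun=> ler01); exact: spec. Qed.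

Let iter_ge0 h f n i : (forall i, 0 <= h i) -> (forall i, 0 <= f i) ->
  0 <= iter n (killed_step q s l h) f i.
Proof.
by move=> h0 f0; elim: n i => [//|n IH] i; rewrite iterS (killed_step_ge0 _ _ qs).
Qed.

Let nneseries_div (a : nat -> R) (c x : R) : 0 < c -> (forall n, 0 <= a n) ->
  (\sum_(n <oo) (a n)%:E = x%:E)%E -> (\sum_(n <oo) (a n / c)%:E = (x / c)%:E)%E.
Proof.
move=> c0 a0 ax; rewrite mulrC EFinM -ax -nneseriesZl; last by move=> n _; rewrite lee_fin.
by apply: eq_eseriesr => n _; rewrite mulrC EFinM.
Qed.

Context (j : E) {d : measure_display} {Omega : measurableType d}
  (P : probability Omega R) (X : R -> Omega -> option E).
Hypothesis chainX : is_markov_chain q j P X.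

Lemma elaplace_law e : elaplace l (fun t => P [set w | X t w = Some e]) =
  (occupation e j / (exit_rate q e + l))%:E.
Proof.
case: chainX => Y [H [mY mH H0 law hX]].
rewrite (elaplace_law_at_time q _ _ _ _ mY mH H0 law _ qs _ l0 _ hX).
apply: nneseries_div => // [n|]; first exact: iter_ge0.
by have [spec _ _] := occupation_spec e (fun=> ler0n _ _) (occupation_super e) (lQ_ge0 e); exact: spec.
Qed.

Lemma elaplace_hitting e : elaplace l (fun t => P [set w | (hitting_time X e w <= t%:E)%E]) =
  (hitting e j / l)%:E.
Proof.
case: chainX => Y [H [mY mH H0 law hX]].
rewrite (elaplace_hitting_time q _ _ _ _ mY mH H0 law _ qs _ l0 _ hX).
apply: nneseries_div => // [n|]; first exact: iter_ge0.
by have [spec _ _] := hitting_spec e (fun=> ler0n _ _) (hitting_super e) (fun=> ler01); exact: spec.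
Qed.

Lemma nonexplosive_cvg0 :
  (forall t, 0 <= t -> (1 <= P (\bigcup_e [set w | X t w = Some e]))%E) ->
  iter n (killed_step q s l (fun=> 1)) (fun=> 1) j @[n --> \oo] --> 0.
Proof.
case: chainX => Y [H [mY mH H0 law hX]].
exact: (nonexplosive_killed_step q _ _ _ _ mY mH H0 law _ qs _ l0 _ hX).
Qed.

Lemma measurable_law e t : 0 <= t -> measurable [set w | X t w = Some e].
Proof.
case: chainX => Y [H [mY mH H0 law hX]].
exact: (measurable_at_time _ _ mY mH _ hX).
Qed.

End markov.

(** * The birth-death chains *)

Lemma laplace_fine {R : realType} (l : R) (F : R -> \bar R) :
  (forall t, 0 <= t -> F t \is a fin_num) ->
  laplace (fun t => fine (F t)) l = fine (elaplace l F).
Proof.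
move=> Ffin; rewrite /laplace /Rintegral; congr fine; apply: eq_integral => t.
by rewrite inE /= in_itv /= andbT => t0; rewrite EFinM fineK ?Ffin.
Qed.

Section rates_of_processes.
Context {R : realType} (r : nat) (alpha beta : nat -> R) (xi : R).
Hypothesis halpha : forall n : nat, (r <= n)%N -> 0 < alpha n.
Hypothesis hbeta : forall n : nat, (r.+1 <= n)%N -> 0 <= beta n.
Hypothesis hxi : 0 < xi.

Local Notation bd := (birth_death_rate r alpha beta).
Local Notation cat := (catastrophe_rate r alpha beta xi).
Local Notation ec := (effective_catastrophe_rate r alpha beta xi).

Definition bd_succs (n : nat) : seq nat :=
  if (n < r)%N then [::] else if n == r then [:: n.+1] else [:: n.+1; n.-1].

Definition cat_succs (n : nat) : seq nat :=
  if (n < r)%N then [::] else if n == r then [:: n.+1]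
  else if n == r.+1 then [:: n.+1; r] else [:: n.+1; n.-1; r].

Definition ec_succs (a : option nat) : seq (option nat) :=
  if a is Some n then map Some (bd_succs n) ++ (if (r < n)%N then [:: None] else [::])
  else [::].

Lemma bd_ge0 n m : 0 <= bd n m.
Proof.
rewrite /birth_death_rate; case: ltnP => // rn; case: ifP => _; first exact/ltW/halpha.
by case: ifP => // /andP[/hbeta].
Qed.

Lemma bd_finitely_many_successors : finitely_many_successors bd bd_succs.
Proof.
split=> [n m|n|n|n m nm]; first exact: bd_ge0.
- rewrite /bd_succs; case: ifP => // _; case: ifP => // _.
  by rewrite /= inE; case: n => //= n; rewrite gtn_eqF// ltnS leqW.
- rewrite /bd_succs; case: ifP => // nr; case: eqP => [->|/eqP nr'].
    by rewrite inE ltn_eqF.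
  have : (r < n)%N by rewrite ltn_neqAle eq_sym nr' leqNgt nr.
  by case: n {nr nr'} => // n _; rewrite !inE ltn_eqF//= gtn_eqF.
- rewrite /bd_succs /birth_death_rate; case: ifP => // nr.
  case: (eqVneq n r) => [->|nr'].
    by rewrite inE => /negbTE ->; rewrite ltnn.
  rewrite !inE negb_or => /andP[/negbTE -> /negbTE ->].
  by rewrite andbF.
Qed.

Lemma cat_finitely_many_successors : finitely_many_successors cat cat_succs.
Proof.
split=> [n m|n|n|n m nm].
- rewrite /catastrophe_rate; case: ltnP => // rn; case: ifP => _; first exact/ltW/halpha.
  case: ifP => _; first by rewrite addr_ge0 ?hbeta// ltW.
  case: ifP => [/andP[rn' _]|_]; first by rewrite hbeta// ltnW.
  by case: ifP => // _; exact: ltW.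
- rewrite /cat_succs; case: ltnP => // rn; case: ifP => // nr; case: ifP => nr1 /=.
    by rewrite inE gtn_eqF.
  have : (r.+1 < n)%N by rewrite !ltn_neqAle eq_sym nr1 eq_sym nr rn.
  case: n {rn nr nr1} => // n; rewrite ltnS => rn /=.
  by rewrite !inE !gtn_eqF// ltnS ltnW// ltnW.
- rewrite /cat_succs; case: ltnP => // rn; case: ifP => // nr; first by rewrite inE ltn_eqF.
  case: ifP => nr1 /=; first by rewrite !inE nr ltn_eqF.
  have : (r < n)%N by rewrite ltn_neqAle eq_sym nr.
  by case: n {rn nr1} nr => // n nr _; rewrite !inE nr ltn_eqF//= gtn_eqF.
- rewrite /cat_succs /catastrophe_rate; case: ltnP => // rn.
  case: (eqVneq n r) => [->|nr].
    by rewrite inE => /negbTE ->; rewrite ltn_eqF// ltnNge leqnSn.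
  case: (eqVneq n r.+1) => [->|nr1].
    by rewrite !inE negb_or => /andP[/negbTE -> /negbTE ->]; rewrite ltnn.
  rewrite !inE !negb_or => /and3P[/negbTE -> /negbTE -> /negbTE ->].
  by rewrite !andbF.
Qed.

Lemma ec_finitely_many_successors : finitely_many_successors ec ec_succs.
Proof.
have [_ us si q0] := bd_finitely_many_successors.
have Some_inj : injective (@Some nat) by move=> ? ? [].
split=> [[n|] [m|] //=|[n|] //=|[n|] //=|[n|] [m|] //= nm].
- exact: bd_ge0.
- by case: ifP => // _; exact: ltW.
- rewrite cat_uniq map_inj_uniq// us; case: ifP => _ //=; rewrite orbF andbT.
  by apply/mapP => -[].
- rewrite mem_cat negb_or mem_map// si; by case: ifP.
- by rewrite mem_cat negb_or mem_map// => /andP[/q0 ->]//; apply: contra nm => /eqP ->.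
- by rewrite mem_cat negb_or; case: ifP; rewrite ?inE ?andbF.
Qed.

(** * Three-term recurrences with cleared denominators *)

Section steps.
Variables (l : R) (l0 : 0 < l).

Lemma bd_step_gt h f i : (r < i)%N ->
  (alpha i + beta i + l) * killed_step bd bd_succs l h f i =
  h i * (alpha i * f i.+1 + beta i * f i.-1).
Proof.
move=> ri; have ai := halpha i (ltnW ri); have bi := hbeta i ri.
have i1 : (i.-1 == i.+1) = false by rewrite ltn_eqF// ltnS leq_pred.
rewrite /killed_step (exit_rateE _ _ bd_finitely_many_successors).
rewrite /bd_succs ltnNge (ltnW ri) /= gtn_eqF// !big_cons !big_nil.
rewrite /birth_death_rate ltnNge (ltnW ri) /= !eqxx ri i1 /= !addr0.
by field; rewrite gt_eqF// ltr_wpDl// addr_ge0// ltW.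
Qed.

Lemma bd_step_r h f :
  (alpha r + l) * killed_step bd bd_succs l h f r = h r * (alpha r * f r.+1).
Proof.
have ai := halpha r (leqnn r).
rewrite /killed_step (exit_rateE _ _ bd_finitely_many_successors).
rewrite /bd_succs ltnn eqxx !big_cons !big_nil.
rewrite /birth_death_rate ltnn !eqxx !addr0.
by field; rewrite gt_eqF// addr_gt0.
Qed.

Lemma bd_exit_rate_r : exit_rate bd r = alpha r.
Proof.
rewrite (exit_rateE _ _ bd_finitely_many_successors).
by rewrite /bd_succs ltnn eqxx big_seq1 /birth_death_rate ltnn eqxx.
Qed.

Lemma cat_step_gt h f i : (r < i)%N ->
  (alpha i + beta i + xi + l) * killed_step cat cat_succs l h f i =
  h i * (alpha i * f i.+1 + beta i * f i.-1 + xi * f r).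
Proof.
move=> ri; have ai := halpha i (ltnW ri); have bi := hbeta i ri.
have D0 : alpha i + beta i + xi + l != 0.
  by rewrite gt_eqF// ltr_wpDl// !addr_ge0// ltW.
rewrite /killed_step (exit_rateE _ _ cat_finitely_many_successors).
rewrite /cat_succs ltnNge (ltnW ri) /= gtn_eqF//.
(* At [r.+1] death and catastrophe lead to the same state and form one successor of rate
   [beta r.+1 + xi]; the resulting equation has the general form. *)
move: ri; rewrite leq_eqVlt => /orP[/eqP ir|ri].
  rewrite -ir eqxx in D0 * ; rewrite !big_cons !big_nil /catastrophe_rate ltnNge leqnSn /= !eqxx.
  rewrite [r == r.+2]ltn_eqF// !addr0 /=.
  by field; move: D0; rewrite !addrA.
have i1 : (i.-1 == i.+1) = false by rewrite ltn_eqF// ltnS leq_pred.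
have i2 : (r == i.+1) = false by rewrite ltn_eqF// ltnW// ltnW.
have i3 : (r == i.-1) = false by rewrite ltn_eqF// -ltnS (ltn_predK ri).
rewrite gtn_eqF// !big_cons !big_nil /catastrophe_rate ltnNge (ltnW (ltnW ri)) /= !eqxx.
rewrite i1 i2 i3 ri gtn_eqF//= !addr0.
by field; move: D0; rewrite !addrA.
Qed.

Lemma ec_step_gt h f i : (r < i)%N ->
  (alpha i + beta i + xi + l) * killed_step ec ec_succs l h f (Some i) =
  h (Some i) * (alpha i * f (Some i.+1) + beta i * f (Some i.-1) + xi * f None).
Proof.
move=> ri; have ai := halpha i (ltnW ri); have bi := hbeta i ri.
have i1 : (i.-1 == i.+1) = false by rewrite ltn_eqF// ltnS leq_pred.
have D0 : alpha i + beta i + xi + l != 0.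
  by rewrite gt_eqF// ltr_wpDl// !addr_ge0// ltW.
rewrite /killed_step (exit_rateE _ _ ec_finitely_many_successors).
rewrite /= /bd_succs ltnNge (ltnW ri) /= gtn_eqF// ri !big_cons !big_nil /=.
rewrite /birth_death_rate ltnNge (ltnW ri) /= !eqxx ri i1 /= !addr0.
by field; move: D0; rewrite !addrA.
Qed.

Lemma ec_step_r h f :
  (alpha r + l) * killed_step ec ec_succs l h f (Some r) =
  h (Some r) * (alpha r * f (Some r.+1)).
Proof.
have ai := halpha r (leqnn r).
rewrite /killed_step (exit_rateE _ _ ec_finitely_many_successors).
rewrite /= /bd_succs ltnn eqxx /= !big_cons !big_nil /=.
rewrite /birth_death_rate ltnn !eqxx !addr0.
by field; rewrite gt_eqF// addr_gt0.
Qed.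

Lemma ec_exit_rate_None : exit_rate ec None = 0.
Proof. by rewrite (exit_rateE _ _ ec_finitely_many_successors) big_nil. Qed.

(* Iterating the inequality gives [|D| <= C * L^n 1]. *)
Lemma bd_bounded_eq0 (D : nat -> R) (C : R) :
  (forall i, (r <= i)%N ->
     iter n (killed_step bd bd_succs l (fun=> 1)) (fun=> 1) i @[n --> \oo] --> 0) ->
  (forall i, (r <= i)%N -> `|D i| <= C) ->
  (forall i, (r < i)%N ->
     (alpha i + beta i + l) * `|D i| <= alpha i * `|D i.+1| + beta i * `|D i.-1|) ->
  (alpha r + l) * `|D r| <= alpha r * `|D r.+1| ->
  forall i, (r <= i)%N -> D i = 0.
Proof.
move=> lim0 DC Dgt Dr.
have C0 : 0 <= C by rewrite (le_trans _ (DC r (leqnn r))).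
have bound n i : (r <= i)%N ->
    `|D i| <= C * iter n (killed_step bd bd_succs l (fun=> 1)) (fun=> 1) i.
  elim: n i => [|n IH] i ri; first by rewrite mulr1 DC.
  set w := iter n _ _ in IH.
  have ai := halpha i ri.
  move: ri; rewrite leq_eqVlt => /orP[/eqP ir|ri].
    rewrite -{}ir in ai *.
    rewrite -(ler_pM2l (x := alpha r + l)) ?addr_gt0// (le_trans Dr)//.
    rewrite mulrCA iterS bd_step_r mul1r mulrCA ler_pM2l//.
    exact: IH.
  have bi := hbeta i ri.
  rewrite -(ler_pM2l (x := alpha i + beta i + l)); last by rewrite ltr_wpDl// addr_ge0// ltW.
  rewrite (le_trans (Dgt i ri))// mulrCA iterS bd_step_gt// mul1r mulrDr !(mulrCA C).
  rewrite lerD// ler_wpM2l// ?(ltW ai)//; first by apply: IH; rewrite ltnW// ltnW.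
  by apply: IH; rewrite -ltnS (ltn_predK ri).
move=> i ri; apply/eqP; rewrite -normr_le0.
have cv : C * iter n (killed_step bd bd_succs l (fun=> 1)) (fun=> 1) i @[n --> \oo] --> 0.
  by rewrite -[X in _ --> X](mulr0 C); apply: cvgMr; exact: lim0.
rewrite -(cvg_lim _ cv)//; apply: limr_ge; first exact: cvgP cv.
by apply: nearW => n; exact: bound.
Qed.

End steps.
End rates_of_processes.

(** The events are disjoint, and states below [r] can only add mass to the sum from [r] on. *)
Lemma nonexplosive_bigcup {R : realType} (r : nat) {d : measure_display}
    {Omega : measurableType d} (P : probability Omega R) (X : Omega -> option nat) :
  (forall n, measurable [set w | X w = Some n]) ->
  (\sum_(r <= n <oo) P [set w | X w = Some n] = 1)%E ->
  (1 <= P (\bigcup_e [set w | X w = Some e]))%E.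
Proof.
move=> mX sum1; rewrite measure_bigcup//; last first.
  by move=> m n _ _ [w [/= -> [->]]].
rewrite (eq_eseriesl (Q := xpredT)); last by move=> n; rewrite in_setT.
rewrite (nneseries_split 0 r)// add0n sum1 leeDr//.
by apply: sume_ge0.
Qed.

(** * Comparison of the four transforms by uniqueness of bounded solutions *)

Theorem mainTheorem7 (R : realType) (r : nat) (alpha beta : nat -> R) (xi : R)
  (halpha : forall n : nat, (r <= n)%N -> 0 < alpha n)
  (hbeta : forall n : nat, (r.+1 <= n)%N -> 0 <= beta n)
  (hxi : 0 < xi)
  (* the process with catastrophes; P j is the law given N(0) = j *)
  (d1 : measure_display) (Omega : measurableType d1)
  (P : nat -> probability Omega R) (N : R -> Omega -> option nat)
  (hN : forall j : nat, (r <= j)%N ->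
     is_markov_chain (catastrophe_rate r alpha beta xi) j (P j) N)
  (* the process without catastrophes, assumed non-explosive *)
  (d2 : measure_display) (Omegahat : measurableType d2)
  (Phat : nat -> probability Omegahat R) (Nhat : R -> Omegahat -> option nat)
  (hNhat : forall j : nat, (r <= j)%N ->
     is_markov_chain (birth_death_rate r alpha beta) j (Phat j) Nhat)
  (hnonexpl : forall (j : nat) (t : R), (r <= j)%N -> 0 <= t ->
     (\sum_(r <= n <oo) Phat j [set w | Nhat t w = Some n])%E = 1%E)
  (* the process absorbed at the first effective catastrophe *)
  (d3 : measure_display) (OmegaM : measurableType d3)
  (PM : nat -> probability OmegaM R) (M : R -> OmegaM -> option (option nat))
  (hM : forall j : nat, (r <= j)%N ->
     is_markov_chain (effective_catastrophe_rate r alpha beta xi) (Some j) (PM j) M) :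
  let pihat (j n : nat) : R -> R :=
    laplace (fun t => fine (Phat j [set w | Nhat t w = Some n])) in
  (forall (j : nat) (dens : R -> R), (r <= j)%N ->
     is_density (fun t => PM j [set w | M t w = Some None]) dens ->
     forall lambda : R, 0 < lambda ->
       laplace dens lambda =
         xi / (lambda + xi)
         - lambda / (lambda + xi) *
           (xi * pihat j r (lambda + xi) / (1 - xi * pihat r r (lambda + xi))))
  /\
  (forall (j : nat) (dens g ghat : R -> R), (r < j)%N ->
     is_density (fun t => PM j [set w | M t w = Some None]) dens ->
     is_density (fun t => P j [set w | (hitting_time N r w <= t%:E)%E]) g ->
     is_density (fun t => Phat j [set w | (hitting_time Nhat r w <= t%:E)%E]) ghat ->
     forall lambda : R, 0 < lambda ->
       laplace dens lambda =
         laplace g lambda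
         - lambda / (lambda + xi) *
           (laplace ghat (lambda + xi) / (1 - xi * pihat r r (lambda + xi)))).
Proof.
move=> pihat.
have bdS := bd_finitely_many_successors r alpha beta halpha hbeta.
have catS := cat_finitely_many_successors r alpha beta xi halpha hbeta hxi.
have ecS := ec_finitely_many_successors r alpha beta xi halpha hbeta hxi.
pose bd := birth_death_rate r alpha beta.
have lim0 mu i : 0 < mu -> (r <= i)%N ->
    iter n (killed_step bd (bd_succs r) mu (fun=> 1)) (fun=> 1) i @[n --> \oo] --> 0.
  move=> mu0 ri; apply: (nonexplosive_cvg0 _ _ bdS mu mu0 i _ _ (hNhat i ri)) => t t0.
  apply: (nonexplosive_bigcup r); last exact: hnonexpl.
  by move=> n; exact: (measurable_law _ _ _ _ (hNhat i ri)).
(* Here [x] is the transform [delta], [y] is [gamma], and [u], [v] are [pihat] and [gammahat] at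
   [lambda + xi]. *)
have main lambda : 0 < lambda ->
  let u := fun i => pihat i r (lambda + xi) in
  let x := occupation (effective_catastrophe_rate r alpha beta xi)
             (ec_succs r) lambda None \o Some in
  let y := hitting (catastrophe_rate r alpha beta xi) (cat_succs r) lambda r in
  let v := hitting bd (bd_succs r) (lambda + xi) r in
  forall i, (r <= i)%N ->
    [/\ x i = xi / (lambda + xi) - xi * (1 - x r) * u i,
        (1 - x r) * (1 - xi * u r) = lambda / (lambda + xi),
        u i = u r * v i & y i = xi / (lambda + xi) + lambda / (lambda + xi) * v i].
  move=> lambda0 u x y v.
  set mu := lambda + xi in u v *.
  have mu0 : 0 < mu by rewrite addr_gt0.
  have mu_neq0 : mu != 0 by rewrite gt_eqF.
  pose o := occupation bd (bd_succs r) mu r.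
  have ar := halpha r (leqnn r).
  have uE i : (r <= i)%N -> u i = o i / (alpha r + mu).
    move=> ri; rewrite /u /pihat laplace_fine; last first.
      move=> t t0; apply: fin_num_measure.
      exact: (measurable_law _ _ _ _ (hNhat i ri)).
    by rewrite (elaplace_law _ _ bdS mu mu0 i _ _ (hNhat i ri)) (bd_exit_rate_r _ _ _ halpha hbeta).
  have u_gt i : (r < i)%N ->
      (alpha i + beta i + mu) * u i = alpha i * u i.+1 + beta i * u i.-1.
    move=> ri; have r1 : (r <= i.-1)%N by rewrite -ltnS (ltn_predK ri).
    rewrite !uE ?(ltnW ri) ?leqW ?(ltnW ri)// mulrA /o (occupationE _ _ bdS)// gtn_eqF// add0r.
    by rewrite bd_step_gt// mul1r; ring.
  have u_r : (alpha r + mu) * u r = alpha r * u r.+1 + 1.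
    have D0 : alpha r + mu != 0 by rewrite gt_eqF// addr_gt0.
    rewrite !uE// mulrA {1}/o (occupationE _ _ bdS)// eqxx mulrDr mulr1 bd_step_r// mul1r -/o.
    by field.
  have u_bound i : (r <= i)%N -> `|u i| <= mu^-1.
    move=> ri; have /andP[occ0 oD] := occupation_bound _ _ bdS mu mu0 r i.
    rewrite (bd_exit_rate_r _ _ _ halpha hbeta) -/o in occ0 oD; rewrite uE//.
    have D0 : 0 < alpha r + mu by rewrite addr_gt0.
    by rewrite ger0_norm ?divr_ge0 ?(ltW D0)// ler_pdivrMr// mulrC.
  have v_r : v r = 1.
    by rewrite /v (hittingE _ _ bdS)// eqxx /killed_step eqxx mul0r addr0.
  have v_gt i : (r < i)%N ->
      (alpha i + beta i + mu) * v i = alpha i * v i.+1 + beta i * v i.-1.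
    move=> ri; rewrite {1}/v (hittingE _ _ bdS)// gtn_eqF// add0r.
    by rewrite bd_step_gt// gtn_eqF//= mul1r.
  have v_bound i : `|v i| <= 1.
    by have /andP[v0 v1] := hitting_bound _ _ bdS mu mu0 r i; rewrite ger0_norm.
  have y_r : y r = 1.
    by rewrite /y (hittingE _ _ catS)// eqxx /killed_step eqxx mul0r addr0.
  (* The catastrophe rate joins the killing rate, [xi + lambda = mu], and the jump to [r] becomes
     the source [xi * y r = xi]. *)
  have y_gt i : (r < i)%N ->
      (alpha i + beta i + mu) * y i = alpha i * y i.+1 + beta i * y i.-1 + xi.
    move=> ri; have -> : alpha i + beta i + mu = alpha i + beta i + xi + lambda.
      by rewrite /mu; ring.
    rewrite {1}/y (hittingE _ _ catS)// gtn_eqF// add0r.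
    by rewrite cat_step_gt// gtn_eqF//= mul1r -/y y_r mulr1.
  have y_bound i : `|y i| <= 1.
    by have /andP[y0 y1] := hitting_bound _ _ catS lambda lambda0 r i; rewrite ger0_norm.
  pose z := occupation (effective_catastrophe_rate r alpha beta xi) (ec_succs r) lambda None.
  have z_None : z None = 1.
    by rewrite /z (occupationE _ _ ecS)// eqxx /killed_step /= big_nil mulr0 addr0.
  have x_gt i : (r < i)%N ->
      (alpha i + beta i + mu) * x i = alpha i * x i.+1 + beta i * x i.-1 + xi.
    move=> ri; have -> : alpha i + beta i + mu = alpha i + beta i + xi + lambda.
      by rewrite /mu; ring.
    rewrite {1}/x /= (occupationE _ _ ecS)//= add0r.
    by rewrite ec_step_gt// mul1r -/z z_None mulr1.
  (* No effective catastrophe occurs at [r], so the coefficient contains [lambda] instead of [mu].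
     This gives the extra term [xi * x r] in the comparison with [u]. *)
  have x_r : (alpha r + lambda) * x r = alpha r * x r.+1.
    by rewrite {1}/x /= (occupationE _ _ ecS)//= add0r ec_step_r// mul1r.
  have x_bound i : `|x i| <= 1.
    have /andP[x0 x1] := occupation_bound _ _ ecS lambda lambda0 None (Some i).
    rewrite ger0_norm//; move: x1.
    by rewrite (ec_exit_rate_None _ _ _ _ halpha hbeta hxi) add0r divff// gt_eqF.
  have uniq (D : nat -> R) C : (forall i, (r <= i)%N -> `|D i| <= C) ->
      (forall i, (r < i)%N ->
         (alpha i + beta i + mu) * D i = alpha i * D i.+1 + beta i * D i.-1) ->
      ((alpha r + mu) * D r = alpha r * D r.+1 \/ D r = 0) ->
      forall i, (r <= i)%N -> D i = 0.
    move=> DC Dgt Dr; apply: (bd_bounded_eq0 r alpha beta halpha hbeta mu mu0 D C) => //.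
    - by move=> i; exact: lim0.
    - move=> i ri; have ai := halpha i (ltnW ri); have bi := hbeta i ri.
      have D0 : 0 <= alpha i + beta i + mu by rewrite !addr_ge0// ltW.
      rewrite -[X in X * _](ger0_norm D0) -normrM Dgt// (le_trans (ler_normD _ _))//.
      by rewrite !normrM (gtr0_norm ai) (ger0_norm bi).
    - case: Dr => [Dr|->]; last by rewrite normr0 mulr0 mulr_ge0// ltW.
      have D0 : 0 <= alpha r + mu by rewrite addr_ge0// ltW.
      by rewrite -[X in X * _](ger0_norm D0) -normrM Dr normrM (gtr0_norm ar).
  (* The constant [xi / mu] absorbs the source [xi] above [r]. At [r] the remaining sources are
     [xi * x r - xi + xi * (1 - x r)], which cancel; this fixes the coefficient of [u]. *)
  have xE i : (r <= i)%N -> x i = xi / mu - xi * (1 - x r) * u i.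
    move=> ri; apply/eqP; rewrite -subr_eq0; apply/eqP.
    apply: (uniq (fun i => x i - (xi / mu - xi * (1 - x r) * u i))
      (1 + (`|xi / mu| + `|xi * (1 - x r)| * mu^-1))) => //.
    + move=> k rk; rewrite (le_trans (ler_normB _ _))// lerD//.
      rewrite (le_trans (ler_normB _ _))// lerD// normrM ler_wpM2l//.
      exact: u_bound.
    + move=> k rk.
      transitivity ((alpha k + beta k + mu) * x k - (alpha k + beta k + mu) * (xi / mu)
        + xi * (1 - x r) * ((alpha k + beta k + mu) * u k)); first by ring.
      by rewrite x_gt// u_gt//; field.
    + left.
      transitivity ((alpha r + mu) * x r - (alpha r + mu) * (xi / mu)
        + xi * (1 - x r) * ((alpha r + mu) * u r)); first by ring.
      have -> : (alpha r + mu) * x r = alpha r * x r.+1 + xi * x r.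
        by rewrite -x_r /mu; ring.
      by rewrite u_r; field.
  move=> i ri; split; first exact: xE.
  - have -> : lambda / mu = 1 - xi / mu.
      by rewrite -[in RHS](divff mu_neq0) -mulrBl /mu addrK.
    have := xE r (leqnn r); move: (x r) (u r) (xi / mu) => a b c; lra.
  (* Both terms satisfy the homogeneous recurrence above [r], and the difference vanishes at [r]
     since [v r = 1]. *)
  - apply/eqP; rewrite -subr_eq0; apply/eqP.
    apply: (uniq (fun i => u i - u r * v i) (mu^-1 + `|u r| * 1)) => //.
    + move=> k rk; apply: (le_trans (ler_normB _ _)); rewrite lerD//; first exact: u_bound.
      by rewrite normrM ler_wpM2l// v_bound.
    + move=> k rk.
      transitivity ((alpha k + beta k + mu) * u k - u r * ((alpha k + beta k + mu) * v k)).
        by ring.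
      by rewrite u_gt// v_gt//; ring.
    + by right; rewrite v_r mulr1 subrr.
  (* Again [xi / mu] absorbs the source; the coefficient [lambda / mu] makes the right-hand side
     equal to 1 at [r]. *)
  - apply/eqP; rewrite -subr_eq0; apply/eqP.
    apply: (uniq (fun i => y i - (xi / mu + lambda / mu * v i))
      (1 + (`|xi / mu| + `|lambda / mu| * 1))) => //.
    + move=> k rk; rewrite (le_trans (ler_normB _ _))// lerD//.
      by rewrite (le_trans (ler_normD _ _))// lerD// normrM ler_wpM2l// v_bound.
    + move=> k rk.
      transitivity ((alpha k + beta k + mu) * y k - (alpha k + beta k + mu) * (xi / mu)
        - lambda / mu * ((alpha k + beta k + mu) * v k)); first by ring.
      by rewrite y_gt// v_gt//; field.
    + by right; rewrite y_r v_r mulr1 -mulrDl [xi + _]addrC -/mu divff// subrr.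
(* The state [None] is absorbing, so the occupation is divided by [0 + lambda] and this factor
   cancels the one from [laplace_density]. *)
have densE j (dens : R -> R) lambda : (r <= j)%N -> 0 < lambda ->
    is_density (fun t => PM j [set w | M t w = Some None]) dens ->
    laplace dens lambda = occupation (effective_catastrophe_rate r alpha beta xi)
             (ec_succs r) lambda None (Some j).
  move=> rj lambda0 hdens; rewrite (laplace_density lambda lambda0 _ _ hdens).
  rewrite (elaplace_law _ _ ecS lambda lambda0 _ _ _ (hM j rj)).
  rewrite (ec_exit_rate_None _ _ _ _ halpha hbeta hxi) add0r /=.
  by field; rewrite gt_eqF.
split=> [j dens rj hdens lambda lambda0|j dens g ghat rj hdens hg hghat lambda lambda0].
  have mu_neq0 : lambda + xi != 0 by rewrite gt_eqF// addr_gt0.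
  rewrite (densE j)//; have [/= -> xr _ _] := main lambda lambda0 j rj.
  (* The denominator is a factor of the positive number [lambda / (lambda + xi)]. *)
  have u_neq : 1 - xi * pihat r r (lambda + xi) != 0.
    apply/eqP => u0; move: xr; rewrite u0 mulr0 => /esym/eqP.
    by rewrite mulf_eq0 invr_eq0 (negbTE mu_neq0) orbF gt_eqF.
  rewrite -xr; move: u_neq; set c := 1 - xi * _ => c_neq.
  by field; rewrite c_neq mu_neq0.
have rj' := ltnW rj.
have mu_neq0 : lambda + xi != 0 by rewrite gt_eqF// addr_gt0.
have mu_gt0 : 0 < lambda + xi by rewrite addr_gt0.
rewrite (densE j)// (laplace_density lambda lambda0 _ _ hg) (laplace_density _ mu_gt0 _ _ hghat).
rewrite (elaplace_hitting _ _ catS lambda lambda0 _ _ _ (hN j rj')).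
rewrite (elaplace_hitting _ _ bdS _ mu_gt0 _ _ _ (hNhat j rj')) /=.
have lK (a c : R) : 0 < c -> c * (a / c) = a.
  by move=> c0; rewrite mulrC divfK// gt_eqF.
rewrite !lK//.
have [xE xr uE yE] := main lambda lambda0 j rj'.
have u_neq : 1 - xi * pihat r r (lambda + xi) != 0.
  apply/eqP => u0; move: xr; rewrite u0 mulr0 => /esym/eqP.
  by rewrite mulf_eq0 invr_eq0 (negbTE mu_neq0) orbF gt_eqF.
have xr' : 1 - (occupation (effective_catastrophe_rate r alpha beta xi) (ec_succs r) lambda None \o Some) r =
   lambda / (lambda + xi) / (1 - xi * pihat r r (lambda + xi)).
  by rewrite -xr mulfK.
(* Everything is expressed through [v] and [pihat r r]; the rest is [v - v / (1 - xi * u) = - xi * u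
   * v / (1 - xi * u)]. *)
rewrite [LHS]xE [X in _ = X - _]yE uE xr'.
move: u_neq; set v := hitting _ _ _ _ _; set u := pihat r r _ => u_neq.
by field; rewrite u_neq mu_neq0.
Qed.
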